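(* There is an absolute constant $c>0$ with the following property. Let $n\ge 1$ be an integer, let $f_0,\dots,f_{n+1}$ be functions analytic on (a neighborhood of) the closed disk $\mathbb D\cup\mathbb T$ with $f_{n+1}=f_0+\dots+f_n$, and assume that the Wronskian $W=W(f_0,\dots,f_n)$ vanishes nowhere on $\mathbb T$. For $0\le j\le n+1$ let $B_j$ be the finite Blaschke product associated with $f_j$, and put $$\mathbf B:=\mathrm{LCM}(B_0,\dots,B_{n+1}),\qquad \mathcal B:=\mathrm{rad}(B_0B_1\cdots B_{n+1}).$$ Then $$c\,\|\mathbf B'\|_\infty\le\|1/W\|_\infty\cdot\left(\|W'\|_\infty+n\,\|W\|_\infty\,\|\mathcal B'\|_\infty\right).$$
   Context: $\mathbb D=\{z\in\mathbb C:|z|<1\}$, $\mathbb T=\partial\mathbb D$, $\|\cdot\|_\infty=\|\cdot\|_{L^\infty(\mathbb T)}$. Wronskian: $W(f_0,\dots,f_n)=\det\big(f_j^{(i)}\big)_{0\le i,j\le n}$ (row $i$ consists of the $i$-th derivatives). Blaschke products: if $f_j$ has distinct zeros $a_1,\dots,a_s$ in the open disk $\mathbb D$ with multiplicities $m_1,\dots,m_s$, then $B_j(z)=\prod_{k=1}^s\left(\frac{z-a_k}{1-\overline{a_k}z}\right)^{m_k}$ (with $B_j=1$ if there are no zeros in $\mathbb D$). $\mathrm{LCM}(B_0,\dots,B_{n+1})$ is the least common multiple, i.e. the Blaschke product whose multiplicity at each point $a\in\mathbb D$ is the maximum of the multiplicities of $a$ as a zero of $B_0,\dots,B_{n+1}$.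 For a Blaschke product $B$, its radical $\mathrm{rad}(B)$ is the Blaschke product having the same distinct zeros as $B$, each with multiplicity one. *)

(* Defs.v *)
From HB Require Import structures.
From mathcomp Require Import all_boot all_order all_algebra.
From mathcomp Require Import complex.
From mathcomp Require Import all_classical all_reals all_analysis.

Set Implicit Arguments.
Unset Strict Implicit.
Unset Printing Implicit Defensive.

Import Order.TTheory GRing.Theory Num.Theory.
Import numFieldNormedType.Exports.

Local Open Scope classical_set_scope.
Local Open Scope ring_scope.

(* R[i] carries no topology by itself; seen as a numFieldType it inherits the
   one that MathComp-Analysis attaches to every numFieldType, namely the metric
   topology of |z|, so that [derive1] is the complex derivative.  Pitfall: the
   order of R[i] is partial (x <= y iff y - x is a nonnegative real) and
   [`|z|] is itself an element of R[i]. *)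
Definition Cplx (R : realType) : numFieldType := R[i].

(* Typed in [Cplx R] so that field operations on the result are those of
   [Cplx R], not of [R[i]]. *)
Definition cplx_conj (R : realType) (z : Cplx R) : Cplx R := conjc z.

Section Analytic.
Variable K : numFieldType.
Implicit Types (f : K -> K) (a z : K) (U : set K).

Definition analytic_at f a : Prop :=
  exists (c : nat -> K) (r : K), 0 < r /\
    forall z, `|z - a| < r ->
      series (fun k => c k * (z - a) ^+ k) @ \oo --> f z.

Definition analytic_near_closed_disk f : Prop :=
  exists U, [/\ open U,
    [set z | `|z| <= 1] `<=` U &
    forall z, U z -> analytic_at f z].

Definition wronskian n (f : 'I_n -> K -> K) (z : K) : K :=
  \det (\matrix_(i < n, j < n) derive1n i (f j) z).

(* [m] is the order of vanishing of [f] at [a] (0 when f(a) <> 0). *)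
Definition has_multiplicity f a (m : nat) : Prop :=
  exists g : K -> K, [/\ analytic_at g a, g a != 0 &
    \forall z \near a, f z = (z - a) ^+ m * g z].

(* Default value 0 if no order exists, i.e. if f is not analytic at a or
   vanishes identically near a. *)
Definition multiplicity f a : nat := get (has_multiplicity f a).

End Analytic.

Section Blaschke.
Variable R : realType.
Local Notation C := (Cplx R).

(* The finite Blaschke product having a zero of multiplicity [m a] at each [a]
   of the open unit disk.  Only factors with [m a != 0] contribute; the finitely
   supported product defaults to 1 if infinitely many factors differ from 1. *)
Definition blaschke (m : C -> nat) (z : C) : C :=
  \big[*%R/1]_(a \in [set a : C | `|a| < 1])
    ((z - a) / (1 - cplx_conj a * z)) ^+ m a.

Definition blaschke_of (f : C -> C) : C -> C := blaschke (multiplicity f).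

Definition blaschke_lcm n (B : 'I_n -> C -> C) : C -> C :=
  blaschke (fun a => \max_(j < n) multiplicity (B j) a)%N.

Definition blaschke_rad (B : C -> C) : C -> C :=
  blaschke (fun a => if B a == 0 then 1%N else 0%N).

End Blaschke.

Section SupNorm.
Variable R : realType.

Definition circle_point (t : R) : Cplx R := (cos t +i* sin t)%C.

Definition arc_measure :=
  mrestr (@lebesgue_measure R) (measurable_itv `[0, 2 * pi[).

(* The norm of L^oo(T), T being parametrized by t |-> e^(it). *)
Definition norm_infty_circle (g : Cplx R -> Cplx R) : \bar R :=
  ('N[arc_measure]_+oo
    [EFin \o (fun t : R => complex.Re `|g (circle_point t)|%R)])%E.

End SupNorm.

Arguments arc_measure : clear implicits.

(* Main.v *)
(** At a zero [a] in the disk of some [f_j], of order [m], the Wronskian vanishes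
    to order at least [m - n]: expand the determinant along the column of [f_j],
    which may replace the first column when [j = n + 1] since that function is
    the sum of the others.  With the Poisson weights
    [P_a(zeta) = (1 - |a|^2) / |zeta - a|^2], the derivative on the circle of a
    finite Blaschke product with multiplicities [m_a] has modulus
    [sum m_a P_a(zeta)].  It therefore suffices to bound [sum k_a P_a(zeta)] by
    [C A M], where [W] vanishes to order at least [k_a] at [a], [|1/W| <= A] and
    [|W'| <= M] on the circle.  Put [rho = 1/(A M)].  No zero of [W] is
    within [rho] of [zeta], and at [z = (1 - rho/2) zeta] one has
    [|W(z)| >= |W(zeta)|/2].  If [b] is the Blaschke product with multiplicities
    [k_a], then [W/b] has modulus
    [|W| <= |W(zeta)| (1 + |xi - zeta|/rho)] at [xi] on the circle, so that the
    maximum principle, after division by [1 + (1 - zeta^* w)/rho], yields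
    [|W(z)/b(z)| <= 3 |W(zeta)|].  Hence [|b(z)| >= 1/6], which bounds
    [sum k_a (1 - |z|^2)(1 - |a|^2)/|1 - a^* z|^2], a quantity comparable with
    [rho sum k_a P_a(zeta)]. *)

Require Import Defs.
From mathcomp Require Import all_boot all_order all_algebra complex.
From mathcomp Require Import all_classical all_reals all_analysis ess_sup_inf.
From mathcomp Require Import ring lra zify.

Set Implicit Arguments.
Unset Strict Implicit.
Unset Printing Implicit Defensive.

Import Order.TTheory GRing.Theory Num.Theory.
Import numFieldNormedType.Exports.

Local Open Scope classical_set_scope.
Local Open Scope ring_scope.

(** * The modulus of complex numbers as a real number *)

Section Modulus.
Variable R : realType.
Local Notation C := (Cplx R).
Implicit Types (z w p : C) (x y e : R).

(** The norm takes values in the partially ordered field [R[i]]; its real part is the same number in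
    [R], where the order is total. *)
Definition cabs z : R := complex.Re (`|z| : R[i]).
Definition toC x : C := (x%:C)%C.

Lemma normE z : `|z| = toC (cabs z).
Proof. by case: z => a b; rewrite /toC /cabs normc_def. Qed.

Lemma toC_inj : injective toC.
Proof. by move=> x y []. Qed.

Lemma toC_le x y : (toC x <= toC y) = (x <= y).
Proof. exact: lecR. Qed.

Lemma toC_lt x y : (toC x < toC y) = (x < y).
Proof. exact: ltcR. Qed.

Lemma toC0 : toC 0 = 0. Proof. by []. Qed.
Lemma toC1 : toC 1 = 1. Proof. by []. Qed.
Lemma toCD x y : toC (x + y) = toC x + toC y.
Proof. exact: (rmorphD (real_complex R)). Qed.
Lemma toCM x y : toC (x * y) = toC x * toC y.
Proof. exact: (rmorphM (real_complex R)). Qed.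
Lemma toCB x y : toC (x - y) = toC x - toC y.
Proof. exact: (rmorphB (real_complex R)). Qed.
Lemma toCV x : toC (x^-1) = (toC x)^-1.
Proof. exact: (fmorphV (real_complex R)). Qed.
Lemma toCX x n : toC (x ^+ n) = toC x ^+ n.
Proof. exact: (rmorphXn (real_complex R)). Qed.
Lemma toC_nat n : toC n%:R = n%:R.
Proof. exact: (rmorph_nat (real_complex R)). Qed.

Lemma cabs_ge0 z : 0 <= cabs z.
Proof. by rewrite -toC_le -normE normr_ge0. Qed.

Lemma cabs0 : cabs 0 = 0.
Proof. by apply: toC_inj; rewrite -normE normr0. Qed.

Lemma cabs1 : cabs 1 = 1.
Proof. by apply: toC_inj; rewrite -normE normr1. Qed.

Lemma cabs_eq0 z : (cabs z == 0) = (z == 0).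
Proof. by rewrite -[RHS]normr_eq0 normE (inj_eq toC_inj _ 0). Qed.

Lemma cabs_gt0 z : (0 < cabs z) = (z != 0).
Proof. by rewrite lt_def cabs_ge0 andbT cabs_eq0. Qed.

Lemma cabsM z w : cabs (z * w) = cabs z * cabs w.
Proof. by apply: toC_inj; rewrite toCM -!normE normrM. Qed.

Lemma cabsN z : cabs (- z) = cabs z.
Proof. by apply: toC_inj; rewrite -!normE normrN. Qed.

Lemma cabsB z w : cabs (z - w) = cabs (w - z).
Proof. by rewrite -cabsN opprB. Qed.

Lemma cabsV z : cabs z^-1 = (cabs z)^-1.
Proof. by apply: toC_inj; rewrite toCV -!normE normfV. Qed.

Lemma cabsX z n : cabs (z ^+ n) = cabs z ^+ n.
Proof. by apply: toC_inj; rewrite toCX -!normE normrX. Qed.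

Lemma cabsD z w : cabs (z + w) <= cabs z + cabs w.
Proof. by rewrite -toC_le toCD -!normE ler_normD. Qed.

Lemma cabs_dist z w : cabs z - cabs w <= cabs (z - w).
Proof. by rewrite lerBlDr; apply: le_trans (cabsD _ _); rewrite subrK. Qed.

Lemma cabs_toC x : cabs (toC x) = `|x|.
Proof. by rewrite /cabs /toC normc_def /= expr0n addr0 sqrtr_sqr. Qed.

Lemma cabs_sum n (F : 'I_n -> C) : cabs (\sum_i F i) <= \sum_i cabs (F i).
Proof.
elim/big_ind2 : _ => [|a b c d h1 h2|//]; first by rewrite cabs0.
exact: le_trans (cabsD _ _) (lerD h1 h2).
Qed.

Lemma cabs_prod (I : Type) (s : seq I) (F : I -> C) :
  cabs (\prod_(i <- s) F i) = \prod_(i <- s) cabs (F i).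
Proof. exact: (big_morph _ cabsM cabs1). Qed.

Lemma cabs_sqr z :
  cabs z ^+ 2 = complex.Re (z : R[i]) ^+ 2 + complex.Im (z : R[i]) ^+ 2.
Proof. by rewrite /cabs normc_def sqr_sqrtr // addr_ge0 ?sqr_ge0. Qed.

Lemma Re_le_cabs z : complex.Re (z : R[i]) <= cabs z.
Proof.
apply: le_trans (ler_norm _) _.
by rewrite -(ler_pXn2r (n := 2)) ?nnegrE ?cabs_ge0// real_normK ?num_real// cabs_sqr; nra.
Qed.

Lemma cabs_conj z : cabs (cplx_conj z) = cabs z.
Proof. by rewrite /cabs /cplx_conj normcJ. Qed.

Lemma mul_conj z : z * cplx_conj z = toC (cabs z ^+ 2).
Proof. by rewrite toCX -normE -(sqr_normc (z : R[i])). Qed.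

Lemma conjB z w : cplx_conj (z - w) = cplx_conj z - cplx_conj w.
Proof. exact: (rmorphB (@conjc R)). Qed.
Lemma cvg_ballP p (P : set C) :
  (\forall z \near p, P z) <->
  exists2 e : R, 0 < e & forall z, cabs (z - p) < e -> P z.
Proof.
split.
  move=> /nbhs_ballP[e /= e0 he].
  (* In [R[i]] the relation $0<e$ already forces [e] to be real, so its real part serves as the
     radius. *)
  have eE : e = toC (complex.Re (e : R[i])).
    by move: (e0); rewrite (ltcE (0 : R[i])) /= => /andP[/eqP h _]; move: h; case: (e) => a b /= ->.
  exists (complex.Re (e : R[i])); first by rewrite -toC_lt -eE.
  by move=> z hz; apply: he; rewrite /ball/= eE normE toC_lt cabsB.
move=> [e e0 he]; apply/nbhs_ballP; exists (toC e); first by rewrite /= -toC0 toC_lt.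
by move=> z; rewrite /ball/= normE toC_lt cabsB; exact: he.
Qed.

End Modulus.

(** * Iterated complex differentiability *)

Section Smooth.
Variable K : numFieldType.
Implicit Types (f g : K -> K) (p q : K) (k n : nat).

Lemma nbhsT (P : set K) p : (forall z, P z) -> \forall z \near p, P z.
Proof. by move=> PT; exact: (filterE (F := nbhs p)). Qed.

(** Each of the first [k] derivatives is required to exist near [p], not only at [p]. The notion
    depends on the germ of [f] alone and passes to sums, products and quotients by induction on
    [k]. *)
Fixpoint smooth k f p : Prop :=
  if k is k'.+1 then (\forall z \near p, derivable f z 1) /\ smooth k' (derive1 f) p
  else True.

Lemma near_eq_derive1 f g p :
  (\forall z \near p, f z = g z) -> \forall z \near p, (derive1 f) z = (derive1 g) z.
Proof.
move=> /near_join; apply: filterS => z fg.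
by rewrite !derive1E; exact: near_eq_derive.
Qed.

Lemma near_eq_derive1n f g p n : (\forall z \near p, f z = g z) ->
  \forall z \near p, derive1n n f z = derive1n n g z.
Proof. by move=> fg; elim: n => [//|n IH]; exact: near_eq_derive1. Qed.

Lemma smooth_near k f g p :
  (\forall z \near p, f z = g z) -> smooth k f p -> smooth k g p.
Proof.
elim: k f g => [//|k IH] f g fg /= [df sf]; split.
  have fg' := near_join fg; move: fg'; apply: filterS2 df => z dfz fgz.
  exact: near_eq_derivable fgz dfz.
by apply: IH sf; exact: near_eq_derive1.
Qed.

Lemma smoothW k f p : smooth k.+1 f p -> smooth k f p.
Proof. by elim: k f => [//|k IH] f /= [df sf]; split => //; exact: IH. Qed.

Lemma smooth_derivable k f p : smooth k.+1 f p -> derivable f p 1.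
Proof. by case=> /nbhs_singleton. Qed.

Lemma smooth_continuous k f p : smooth k.+1 f p -> {for p, continuous f}.
Proof.
move=> /smooth_derivable/derivable1_diffP; exact: differentiable_continuous.
Qed.

Lemma smooth_cst k (c : K) p : smooth k (fun=> c) p.
Proof.
elim: k c => [//|k IH] c /=; split; first by apply: nbhsT => z; exact: derivable_cst.
apply: smooth_near (IH 0); apply: nbhsT => z.
by rewrite (derive1_cst (c : K^o)).
Qed.

Lemma smooth_id k p : smooth k id p.
Proof.
case: k => [//|k]; split; first by apply: nbhsT => z; exact: derivable_id.
apply: smooth_near (smooth_cst k 1 p); apply: nbhsT => z.
by rewrite derive1E derive_id.
Qed.

Lemma smoothD k f g p :
  smooth k f p -> smooth k g p -> smooth k (fun z => f z + g z) p.
Proof.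
elim: k f g => [//|k IH] f g /= [df sf] [dg sg]; split.
  by apply: filterS2 df dg => z; exact: derivableD.
apply: smooth_near (IH _ _ sf sg).
apply: filterS2 df dg => z dfz dgz; rewrite !derive1E.
by rewrite -(deriveD dfz dgz).
Qed.

Lemma smoothM k f g p :
  smooth k f p -> smooth k g p -> smooth k (fun z => f z * g z) p.
Proof.
elim: k f g => [//|k IH] f g sf sg.
have [df sf'] := sf; have [dg sg'] := sg; split.
  by apply: filterS2 df dg => z; exact: derivableM.
apply: smooth_near (smoothD (IH _ _ (smoothW sf) sg') (IH _ _ (smoothW sg) sf')).
apply: filterS2 df dg => z dfz dgz; rewrite !derive1E.
by rewrite (deriveM dfz dgz).
Qed.

Lemma smoothN k f p : smooth k f p -> smooth k (fun z => - f z) p.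
Proof.
move=> sf; apply: smooth_near (smoothM (smooth_cst k (-1) p) sf).
by apply: nbhsT => z; rewrite mulN1r.
Qed.

Lemma smoothB k f g p :
  smooth k f p -> smooth k g p -> smooth k (fun z => f z - g z) p.
Proof. by move=> sf sg; exact: smoothD (smoothN sg). Qed.

Lemma smoothX k f p n : smooth k f p -> smooth k (fun z => f z ^+ n) p.
Proof.
move=> sf; elim: n => [|n IH]; first exact: smooth_cst.
apply: smooth_near (smoothM sf IH); apply: nbhsT => z; by rewrite exprS.
Qed.

(** The derivative $-f'(1/f)^2$ of order-[k.+1] data involves $1/f$ only to order [k], so the
    induction closes. *)
Lemma smoothV k f p : f p != 0 -> smooth k f p -> smooth k (fun z => (f z)^-1) p.
Proof.
move=> fp0; elim: k => [//|k IH] sf; have [df sf'] := sf.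
have fz0 : \forall z \near p, f z != 0.
  have cf : {for p, continuous f} := smooth_continuous sf.
  exact: cvgr_neq0 cf fp0.
split; first by apply: filterS2 df fz0 => z dfz fz; exact: derivableV.
have IHk := IH (smoothW sf).
apply: smooth_near (smoothN (smoothM sf' (smoothX 2 IHk))).
apply: filterS2 df fz0 => z dfz fz; rewrite !derive1E.
by rewrite (deriveV fz dfz) exprVn scaleNr mulrC.
Qed.

Lemma smooth_sum k p (I : Type) (s : seq I) (F : I -> K -> K) :
  (forall i, smooth k (F i) p) -> smooth k (fun z => \sum_(i <- s) F i z) p.
Proof.
move=> sF; elim: s => [|i s IH].
  by apply: smooth_near (smooth_cst k 0 p); apply: nbhsT => z; rewrite big_nil.
apply: smooth_near (smoothD (sF i) IH).
by apply: nbhsT => z; rewrite big_cons.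
Qed.

Lemma smooth_prod k p (I : eqType) (s : seq I) (F : I -> K -> K) :
  (forall i, i \in s -> smooth k (F i) p) ->
  smooth k (fun z => \prod_(i <- s) F i z) p.
Proof.
elim: s => [|i s IH] sF.
  by apply: smooth_near (smooth_cst k 1 p); apply: nbhsT => z; rewrite big_nil.
have sP := IH (fun j js => sF j (mem_behead (s := i :: s) js)).
apply: smooth_near (smoothM (sF i (mem_head _ _)) sP).
by apply: nbhsT => z; rewrite big_cons.
Qed.

Lemma smooth_det k p n (A : K -> 'M[K]_n) :
  (forall i j, smooth k (fun z => A z i j) p) ->
  smooth k (fun z => \det (A z)) p.
Proof.
move=> sA; rewrite /determinant; apply: smooth_sum => s.
by apply: smoothM; [exact: smooth_cst | apply: smooth_prod => i _].
Qed.

End Smooth.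

(** * Epsilon-delta derivatives and the mean value inequality *)

Section DerivativeEps.
Variable K : numFieldType.
Implicit Types (f : K -> K) (p l e : K).

Lemma is_derive1P f p l :
  is_derive p 1 f l <->
  forall e, 0 < e -> exists2 d, 0 < d & forall h, `|h| < d ->
    `|f (p + h) - f p - l * h| <= e * `|h|.
Proof.
split.
  move=> [df <-] e e0.
  have /eqaddoP/(_ e e0) := derivable_nbhs df; move=> /(@nbhs_norm0P _ K^o)[d d0 H].
  exists d => // h /H /=; rewrite !fctE /= [_%:A]mulr1 opprD addrA [h + p]addrC.
  by rewrite -[h *: _]/(h * _) [h * _]mulrC.
move=> H.
have cl : h^-1 *: ((f \o shift p) (h *: 1) - f p) @[h --> 0^'] --> l.
  apply/cvgrPdist_le => e e0.
  rewrite near_withinE; apply/(@nbhs_norm0P K K^o).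
  have [d d0 hd] := H e e0; exists d => // h /hd hh h0 /=; rewrite [h%:A]mulr1.
  have hp : 0 < `|h| by rewrite normr_gt0.
  rewrite distrC -(ler_pM2r hp) -normrM.
  have -> : (h^-1 *: (f (h + p) - f p) - l) * h = f (p + h) - f p - l * h.
    rewrite mulrBl [h + p]addrC; congr (_ - _).
    by rewrite -[h^-1 *: _]/(h^-1 * _) mulrC mulrA mulfV // mul1r.
  exact: hh.
by apply: DeriveDef; [apply/cvg_ex; exists l | exact: cvg_lim cl].
Qed.

End DerivativeEps.

Section ComplexDerivative.
Variable R : realType.
Local Notation C := (Cplx R).
Implicit Types (f : C -> C) (p z w l : C) (e M : R).

Lemma toC_surj_gt0 (e : C) : 0 < e -> exists2 x : R, 0 < x & e = toC x.
Proof.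
case: e => a b; rewrite (ltcE (0 : R[i])) /= => /andP[/eqP -> a0].
by exists a.
Qed.

Lemma is_derive_cabs f p l :
  is_derive p 1 f l <->
  forall e, 0 < e -> exists2 d : R, 0 < d & forall h : C, cabs h < d ->
    cabs (f (p + h) - f p - l * h) <= e * cabs h.
Proof.
split.
  move=> /is_derive1P H e e0.
  have [|d d0 hd] := H (toC e); first by rewrite -toC0 toC_lt.
  have [x x0 dx] := toC_surj_gt0 d0; exists x => // h hx.
  by rewrite -toC_le toCM -!normE; apply: hd; rewrite dx normE toC_lt.
move=> H; apply/is_derive1P => e /toC_surj_gt0[x x0 ->].
have [d d0 hd] := H x x0; exists (toC d); first by rewrite -toC0 toC_lt.
by move=> h; rewrite !normE toC_lt -toCM toC_le; exact: hd.
Qed.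

Lemma smooth_expansion k f p : smooth k.+1 f p ->
  forall e, 0 < e -> exists2 d : R, 0 < d & forall h : C, cabs h < d ->
    cabs (f (p + h) - f p - derive1 f p * h) <= e * cabs h.
Proof.
move=> sf.
have df := @smooth_derivable _ k f p sf.
have df' := derivableP df.
rewrite (@derive1E (Cplx R) _ f p).
exact: (is_derive_cabs f p _).1 df'.
Qed.

(* Differentiate the real function [t |-> Re (w^* f (a + t (b - a)))], where
   [w = f b - f a], so that its increment over [0, 1] is [|w|^2]. *)
Lemma segment_mean_value f a b M :
  (forall t : R, 0 <= t <= 1 ->
     derivable f (a + toC t * (b - a)) 1 /\
     cabs (derive1 f (a + toC t * (b - a))) <= M) ->
  cabs (f b - f a) <= M * cabs (b - a).
Proof.
move=> H; set w := f b - f a.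
have M0 : 0 <= M by apply: le_trans (cabs_ge0 _) (H 0 _).2; rewrite lexx ler01.
have [w0|w0] := eqVneq w 0; first by rewrite w0 cabs0 mulr_ge0 ?cabs_ge0.
pose u := cplx_conj w.
pose g (t : R) : R := complex.Re (u * f (a + toC t * (b - a)) : R[i]).
pose g' (t : R) : R :=
  complex.Re (u * (derive1 f (a + toC t * (b - a)) * (b - a)) : R[i]).
have dg (t : R) : 0 <= t <= 1 -> is_derive t 1 g (g' t).
  move=> /H[/derivableP df _]; apply/is_derive1P => e e0.
  set p := a + toC t * (b - a) in df.
  have N0 : 0 < cabs u * cabs (b - a) + 1.
    by rewrite ltr_wpDl // mulr_ge0 ?cabs_ge0.
  (* The chain rule by hand: an increment [h] of [t] moves the argument by [h] times $b-a$, and the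
     error is then multiplied by [u]. The summand 1 keeps the denominator positive. *)
  have [|d d0 hd] := (is_derive_cabs _ _ _).1 df (e / (cabs u * cabs (b - a) + 1)).
    by rewrite divr_gt0.
  have N1 : 0 < cabs (b - a) + 1 by rewrite ltr_wpDl ?cabs_ge0.
  exists (d / (cabs (b - a) + 1)); first by rewrite divr_gt0.
  move=> h hh.
  have hp : cabs (toC h * (b - a)) < d.
    rewrite cabsM cabs_toC; move: hh; rewrite ltr_pdivlMr //.
    by apply: le_lt_trans; rewrite ler_pM ?cabs_ge0 ?normr_ge0// lerDl.
  have -> : g (t + h) - g t - g' t * h =
      complex.Re (u * (f (p + toC h * (b - a)) - f p - 'D_1 f p * (toC h * (b - a))) : R[i]).
    rewrite /g /g' toCD mulrDl addrA -/p (@derive1E (Cplx R) _ f p).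
    have key (v x1 x2 x3 x4 : C) : complex.Re (v * x1 : R[i]) - complex.Re (v * x2 : R[i])
        - complex.Re (v * (x3 * x4) : R[i]) * h =
        complex.Re (v * (x1 - x2 - x3 * (toC h * x4)) : R[i]).
      by case: v x1 x2 x3 x4 => [? ?] [? ?] [? ?] [? ?] [? ?]; rewrite /toC /=; ring.
    exact: key.
  apply: (@le_trans _ _ (cabs u * (e / (cabs u * cabs (b - a) + 1) * cabs (toC h * (b - a))))).
    rewrite ler_norml; apply/andP; split.
      rewrite lerNl; set X := u * _.
      have -> : - complex.Re (X : R[i]) = complex.Re (- X : R[i]) by case: X.
      apply: le_trans (Re_le_cabs _) _; rewrite cabsN /X cabsM.
      by rewrite ler_wpM2l ?cabs_ge0 // hd.
    apply: le_trans (Re_le_cabs _) _; rewrite cabsM.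
    by rewrite ler_wpM2l ?cabs_ge0 // hd.
  rewrite cabsM cabs_toC.
  have -> : cabs u * (e / (cabs u * cabs (b - a) + 1) * (`|h| * cabs (b - a))) =
    e * `|h| * ((cabs u * cabs (b - a)) / (cabs u * cabs (b - a) + 1)) by ring.
  rewrite ler_piMr ?mulr_ge0 ?normr_ge0 ?(ltW e0)//.
  by rewrite ler_pdivrMr // mul1r lerDl.
have cg : {within `[(0:R), 1], continuous g}.
  apply: derivable_within_continuous => t; rewrite in_itv /= => ht.
  by have [] := dg t ht.
have dg' (x : R) : x \in `]0, 1[%R -> is_derive x 1 g (g' x).
  by rewrite in_itv /= => /andP[x0 x1]; apply: dg; rewrite !ltW.
have [c] := MVT ltr01 dg' cg; rewrite in_itv /= => /andP[c0 c1].
rewrite subr0 mulr1 => gE.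
have : g 1 - g 0 = cabs w ^+ 2.
  rewrite /g toC0 toC1 mul0r mul1r addr0 [a + _]addrC subrK.
  have -> : complex.Re (u * f b : R[i]) - complex.Re (u * f a : R[i]) =
    complex.Re (u * w : R[i]).
    by rewrite /w; move: (u) (f b) (f a) => [x1 y1] [x2 y2] [x3 y3] /=; ring.
  by rewrite /u mulrC mul_conj.
rewrite gE => gw.
have w2 : cabs w ^+ 2 <= cabs w * (M * cabs (b - a)).
  rewrite -gw /g'; apply: le_trans (Re_le_cabs _) _.
  rewrite !cabsM cabs_conj ler_wpM2l ?cabs_ge0 // ler_wpM2r ?cabs_ge0 //.
  by apply: (H c _).2; rewrite !ltW.
by move: w2; rewrite expr2 ler_pM2l // cabs_gt0.
Qed.

End ComplexDerivative.

Section TaylorRemainder.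
Variable K : numFieldType.
Implicit Types (f : K -> K) (a b c p z : K).

(** The second Taylor remainder when [c], [a], [b] are $f(p)$, $f'(p)$, $f''(p)$. Its derivative is
    then the first-order remainder of $f'$. *)
Definition taylor_remainder f p c a b z :=
  f z - c - a * (z - p) - b / 2 * (z - p) ^+ 2.

Lemma taylor_remainder_at f p a b : taylor_remainder f p (f p) a b p = 0.
Proof. by rewrite /taylor_remainder; ring. Qed.

Lemma is_derive_taylor_remainder f p c a b z : derivable f z 1 ->
  is_derive z 1 (taylor_remainder f p c a b) (derive1 f z - a - b * (z - p)).
Proof.
move=> /derivableP dfz; rewrite derive1E.
have -> : taylor_remainder f p c a b =
    (fun z => f z - c - a * (z - p) - b / 2 * ((z - p) * (z - p))).
  by apply/funext => w; rewrite /taylor_remainder expr2.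
apply: is_derive_eq; rewrite -![_ *: _]/(_ * _).
by field.
Qed.

End TaylorRemainder.

(** * The maximum principle *)

Section FourthRoots.
Variables (K : comNzRingType) (j s : K).
Hypothesis j2 : j * j = -1.

(** This identity and the next remove the linear and quadratic Taylor terms from a mean over four
    points around the centre. *)
Lemma sum_fourth_roots1 : \sum_(i < 4) j ^+ i * s = 0.
Proof.
rewrite !big_ord_recr big_ord0 /=; transitivity ((1 + j) * (1 + j * j) * s).
  by ring.
by rewrite j2 subrr mulr0 mul0r.
Qed.

Lemma sum_fourth_roots2 : \sum_(i < 4) (j ^+ i * s) ^+ 2 = 0.
Proof.
rewrite !big_ord_recr big_ord0 /=.
transitivity ((1 + j * j) * (1 + (j * j) ^+ 2) * s ^+ 2); first by ring.
by rewrite j2 subrr !mul0r.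
Qed.

End FourthRoots.

(** In use [y] is $|f(p)|$, [P] is $|p|^2$, the [a_i] are the moduli of [f] at the four points and
    $ks^2$ is the Taylor error. For the sum $x$ of the [a_i], Cauchy-Schwarz and maximality give
    $x^2\le 16y^2-16es^2$, the Taylor bound gives $x^2\ge 16y^2-32yks^2$, and $es^2=4yks^2+4ks^2$
    makes these incompatible. *)
Lemma four_point_arith (F : realFieldType) (y e k s P a1 a2 a3 a4 : F) :
  0 <= y -> 0 < e -> 0 < s -> 0 < k -> 4 * k * y + 4 * k = e ->
  0 <= a1 -> 0 <= a2 -> 0 <= a3 -> 0 <= a4 ->
  a1 ^+ 2 + a2 ^+ 2 + a3 ^+ 2 + a4 ^+ 2 + e * (4 * P + 4 * s ^+ 2) <=
    4 * (y ^+ 2 + e * P) ->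
  4 * y - 4 * (k * s ^+ 2) <= a1 + a2 + a3 + a4 -> False.
Proof.
move=> y0 e0 s0 k0 ky p1 p2 p3 p4 hm h4.
have cauchy : (a1 + a2 + a3 + a4) ^+ 2 <= 4 * (a1 ^+ 2 + a2 ^+ 2 + a3 ^+ 2 + a4 ^+ 2).
  have := sqr_ge0 (a1 - a2); have := sqr_ge0 (a1 - a3); have := sqr_ge0 (a1 - a4).
  have := sqr_ge0 (a2 - a3); have := sqr_ge0 (a2 - a4); have := sqr_ge0 (a3 - a4).
  by rewrite !expr2; nra.
have A0 : 0 <= a1 + a2 + a3 + a4 by rewrite !addr_ge0.
have s2 : 0 < s ^+ 2 by rewrite exprn_gt0.
move: (a1 + a2 + a3 + a4) A0 h4 cauchy => x x0 h4 cauchy.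
have q0 : 0 < k * s ^+ 2 by rewrite mulr_gt0.
have kyq : 4 * (k * s ^+ 2) * y + 4 * (k * s ^+ 2) = e * s ^+ 2 by rewrite -ky; ring.
move: (k * s ^+ 2) q0 h4 kyq => q q0 h4 kyq.
have lower : 16 * y ^+ 2 - 32 * (y * q) <= x ^+ 2.
  (* The lower bound on [x] may be squared only if it is nonnegative, that is for $q\le y$;
     otherwise $16y^2-32yq\le 0$. *)
  have [yq|/ltW yq] := leP q y.
    have hx : 0 <= (x - (4 * y - 4 * q)) * (x + (4 * y - 4 * q)).
      by apply: mulr_ge0; lra.
    by have := sqr_ge0 q; rewrite !expr2 in hx *; lra.
  have h0 : 0 <= y * (q - y) by rewrite mulr_ge0 // subr_ge0.
  have h1 : 0 <= y * q by rewrite mulr_ge0 // ltW.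
  by have := sqr_ge0 x; rewrite !expr2 in h0 *; lra.
have es : 0 < e * s ^+ 2 by rewrite mulr_gt0.
have : 4 * (e * s ^+ 2) <= 8 * (y * q) by lra.
have -> : e * s ^+ 2 = 4 * (y * q) + 4 * q by rewrite -kyq; ring.
have : 0 <= y * q by rewrite mulr_ge0 // ltW.
lra.
Qed.

Section MaximumPrinciple.
Variable R : realType.
Local Notation C := (Cplx R).
Implicit Types (f : C -> C) (p z w : C) (e M : R).

Lemma continuous_cabs_fun : continuous (@cabs R : C -> R).
Proof.
move=> p; apply/(@cvgrPdist_lt _ _ _ (nbhs p) (nbhs_filter p)) => e e0; apply/cvg_ballP.
exists e => // z; apply: le_lt_trans; rewrite ler_norml.
by rewrite lerNl opprB cabs_dist (cabsB z p) cabs_dist.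
Qed.

(** Compactness of the disk and convergence of series are obtained in real coordinates and carried
    over by this continuous map. *)
Definition of_pair (v : R * R) : C := (v.1 +i* v.2)%C.

Lemma continuous_of_pair : continuous of_pair.
Proof.
move=> v; apply/cvgrPdist_lt => e /toC_surj_gt0[x x0 ->].
have h1 : \forall w \near v, `|v.1 - w.1| < x / 2.
  have c1 : (w : R * R).1 @[w --> v] --> v.1 by exact: cvg_fst.
  by move/cvgrPdist_lt : c1; apply; rewrite divr_gt0.
have h2 : \forall w \near v, `|v.2 - w.2| < x / 2.
  have c2 : (w : R * R).2 @[w --> v] --> v.2 by exact: cvg_snd.
  by move/cvgrPdist_lt : c2; apply; rewrite divr_gt0.
apply: filterS2 h1 h2 => w h1 h2.
rewrite normE toC_lt.
have -> : of_pair v - of_pair w = toC (v.1 - w.1) + toC (v.2 - w.2) * (0 +i* 1)%C.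
  by rewrite /toC /of_pair /=; apply/eqP; rewrite eq_complex /=; apply/andP; split; apply/eqP => /=; ring.
apply: le_lt_trans (cabsD _ _) _; rewrite cabsM !cabs_toC.
have -> : cabs ((0 +i* 1)%C : C) = 1.
  by rewrite /cabs normc_def /= expr0n expr1n add0r sqrtr1.
by rewrite mulr1 (splitr x) ltrD.
Qed.

Lemma compact_disk : compact [set v : R * R | v.1 ^+ 2 + v.2 ^+ 2 <= 1].
Proof.
apply: (@subclosed_compact _ _ (`[(-1 : R), 1] `*` `[(-1 : R), 1])).
- have -> : [set v : R * R | v.1 ^+ 2 + v.2 ^+ 2 <= 1] =
    (fun v : R * R => v.1 ^+ 2 + v.2 ^+ 2) @^-1` [set x | x <= 1] by [].
  apply: closed_comp; last exact: closed_le.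
  move=> v _; apply: cvgD; apply: cvgM; try exact: cvg_fst; exact: cvg_snd.
- by apply: compact_setX; exact: segment_compact.
- by move=> [x y] /= h; rewrite !in_itv /=; split; apply/andP; split; nra.
Qed.

(** The Taylor remainder [g] vanishes at [p], and on the segment its derivative is the first-order
    error of $f'$, at most $e|h|$; the mean value inequality gives $e|h|^2$. *)
Lemma second_order_expansion f p : smooth 2 f p -> exists a b : C,
  forall e, 0 < e -> exists2 d : R, 0 < d & forall h : C, cabs h < d ->
    cabs (f (p + h) - f p - a * h - b * h ^+ 2) <= e * cabs h ^+ 2.
Proof.
move=> [df sf]; exists (derive1 f p), (derive1 (derive1 f) p / 2) => e e0.
have sf1 : smooth 1 (derive1 f) p := sf.
have [d1 d10 hd1] := smooth_expansion sf1 e0.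
have [d2 d20 hd2] := (cvg_ballP _ _).1 df.
exists (Num.min d1 d2); first by rewrite lt_min d10.
move=> h; rewrite lt_min => /andP[h1 h2].
set a := derive1 f p; set b := derive1 (derive1 f) p.
pose g := taylor_remainder f p (f p) a b.
have gp : g p = 0 := taylor_remainder_at f p a b.
have dg z : derivable f z 1 -> is_derive (z : C) 1 g (derive1 f z - a - b * (z - p)).
  exact: is_derive_taylor_remainder.
have <- : g (p + h) = f (p + h) - f p - a * h - b / 2 * h ^+ 2.
  by rewrite /g /taylor_remainder [p + h - p]addrC addKr.
have := @segment_mean_value R g p (p + h) (e * cabs h).
rewrite gp subr0 [p + h - p]addrC addKr.
have -> : e * cabs h * cabs h = e * cabs h ^+ 2 by rewrite -mulrA -expr2.
apply.
move=> t /andP[t0 t1].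
have ht : cabs (toC t * h) <= cabs h.
  by rewrite cabsM cabs_toC ger0_norm // ler_piMl ?cabs_ge0.
have dft : derivable f (p + toC t * h) 1.
  by apply: hd2; rewrite [p + _]addrC addrK; exact: le_lt_trans ht h2.
have := dg _ dft => dgt; split; first by case: dgt.
rewrite (@derive1E (Cplx R) _ g) derive_val [X in b * X]addrC addKr.
apply: le_trans (hd1 _ (le_lt_trans ht h1)) _.
by rewrite ler_wpM2l // ltW.
Qed.

(* At an interior maximum p of [|f|^2 + e |z|^2] the mean of f over the four
   points [p + i^k s] is [f p + o(s^2)], whereas the mean of [|z|^2] exceeds
   [|p|^2] by [s^2]. *)
Lemma no_interior_max f p (e : R) : 0 < e -> smooth 2 f p ->
  ~ (\forall z \near p, cabs (f z) ^+ 2 + e * cabs z ^+ 2 <=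
                        cabs (f p) ^+ 2 + e * cabs p ^+ 2).
Proof.
move=> e0 sf /cvg_ballP[r r0 hr].
set y := cabs (f p); have y0 : 0 <= y := cabs_ge0 _.
have [a [b hab]] := second_order_expansion sf.
(* The tolerance [k] solves $4k(y+1)=e$, the relation that [four_point_arith] requires. *)
have [|d d0 hd] := hab (e / (4 * (y + 1))).
  by rewrite divr_gt0 // mulr_gt0 // ltr_wpDl.
set k := e / _ in hd.
pose s := Num.min r d / 2.
have s0 : 0 < s by rewrite divr_gt0 // lt_min r0.
have sr : s < Num.min r d by rewrite /s ltr_pdivrMr // mulrDr mulr1 ltrDl lt_min r0.
move: (sr); rewrite lt_min => /andP[sltr sltd].
pose I : C := (0 +i* 1)%C.
have I2 : I * I = -1 by rewrite /I; apply/eqP; rewrite eq_complex /=; apply/andP; split; apply/eqP => /=; ring.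
have cI : cabs I = 1 by rewrite /cabs normc_def /= expr0n expr1n add0r sqrtr1.
have cs : cabs (toC s : C) = s by rewrite cabs_toC gtr0_norm.
pose h : 'I_4 -> C := fun i => I ^+ i * toC s.
have ch i : cabs (h i) = s by rewrite /h cabsM cabsX cI expr1n mul1r.
have S1 : \sum_i h i = 0.
  exact: sum_fourth_roots1.
have S2 : \sum_i h i ^+ 2 = 0 by exact: sum_fourth_roots2.
have Sbound : cabs (\sum_i f (p + h i) - 4 * f p) <= 4 * (k * s ^+ 2).
  have -> : \sum_i f (p + h i) - 4 * f p =
    \sum_i (f (p + h i) - f p - a * h i - b * h i ^+ 2).
    rewrite !sumrB -!mulr_sumr S1 S2 !mulr0 !subr0.
    by rewrite sumr_const card_ord mulr_natl.
  apply: le_trans (cabs_sum _) _.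
  have -> : 4 * (k * s ^+ 2) = \sum_(i < 4) k * s ^+ 2.
    by rewrite sumr_const card_ord mulr_natl.
  apply: ler_sum => i _; have := hd (h i); rewrite ch; exact.
have hmax : \sum_i (cabs (f (p + h i)) ^+ 2 + e * cabs (p + h i) ^+ 2) <=
    4 * (y ^+ 2 + e * cabs p ^+ 2).
  have -> : 4 * (y ^+ 2 + e * cabs p ^+ 2) = \sum_(i < 4) (y ^+ 2 + e * cabs p ^+ 2).
    by rewrite sumr_const card_ord mulr_natl.
  by apply: ler_sum => i _; apply: hr; rewrite [p + _]addrC addrK ch.
have par : \sum_i cabs (p + h i) ^+ 2 = 4 * cabs p ^+ 2 + 4 * s ^+ 2.
  have i2 : I ^+ 2 = -1 by rewrite expr2.
  have i3 : I ^+ 3 = - I by rewrite exprS i2 mulrN1.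
  rewrite !big_ord_recr big_ord0 /= add0r /h /= expr0 expr1 i2 i3.
  rewrite mul1r !cabs_sqr /toC /I.
  by case: (p) => x1 y1 /=; ring.
have := Sbound.
move: hmax; rewrite big_split /= -mulr_sumr par.
rewrite !big_ord_recr !big_ord0 /= !add0r.
move: (f (p + _)) (f (p + _)) (f (p + _)) (f (p + _)) => z4 z3 z2 z1 hm hs.
have ky : 4 * k * y + 4 * k = e.
  by rewrite /k; field; rewrite gt_eqF // ltr_wpDl.
have k0 : 0 < k by rewrite /k divr_gt0 // mulr_gt0 // ltr_wpDl.
have h4 : 4 * y - 4 * (k * s ^+ 2) <= cabs z1 + cabs z2 + cabs z3 + cabs z4.
  have e4 : cabs (4 * f p) = 4 * y.
    by rewrite cabsM -(toC_nat R 4) cabs_toC ger0_norm.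
  have t1 : cabs (4 * f p) <= cabs (z1 + z2 + z3 + z4) + cabs (z1 + z2 + z3 + z4 - 4 * f p).
    by rewrite cabsB -lerBlDl; exact: cabs_dist.
  rewrite lerBlDr -e4; apply: le_trans t1 _; apply: lerD; last exact: hs.
  apply: le_trans (cabsD _ _) _; rewrite lerD2r.
  by apply: le_trans (cabsD _ _) _; rewrite lerD2r; exact: cabsD.
exact: (four_point_arith y0 e0 s0 k0 ky (cabs_ge0 z1) (cabs_ge0 z2) (cabs_ge0 z3) (cabs_ge0 z4) hm h4).
Qed.

(** For every $e>0$ the function $|f|^2+e|z|^2$ attains its maximum over the compact disk, and by
    [no_interior_max] it does so on the circle, where it is at most $M^2+e$. *)
Lemma maximum_principle f M :
  (forall z, cabs z <= 1 -> smooth 2 f z) ->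
  (forall z, cabs z = 1 -> cabs (f z) <= M) ->
  forall z, cabs z <= 1 -> cabs (f z) <= M.
Proof.
move=> sf fM z hz.
have M0 : 0 <= M by apply: le_trans (cabs_ge0 _) (fM 1 (cabs1 R)).
rewrite -(ler_pXn2r (n := 2)) ?nnegrE ?cabs_ge0//.
apply/ler_addgt0Pr => e e0.
pose D := [set v : R * R | v.1 ^+ 2 + v.2 ^+ 2 <= 1].
pose phi (v : R * R) := cabs (f (of_pair v)) ^+ 2 + e * cabs (of_pair v) ^+ 2.
have cE v : cabs (of_pair v) ^+ 2 = v.1 ^+ 2 + v.2 ^+ 2 by rewrite cabs_sqr.
have DE v : D v -> cabs (of_pair v) <= 1.
  by rewrite /D /= -cE -[1 in X in _ <= X](expr1n R 2) ler_pXn2r ?nnegrE ?cabs_ge0.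
have cphi : {within D, continuous phi}.
  apply: continuous_in_subspaceT => v /set_mem /DE hv.
  have cf : {for (of_pair v), continuous f} := smooth_continuous (sf _ hv).
  have c1 : cabs (f (of_pair w)) @[w --> v] --> cabs (f (of_pair v)).
    apply: (continuous_comp (g := @cabs R)); last exact: continuous_cabs_fun.
    by apply: (continuous_comp (g := f)); [exact: continuous_of_pair | exact: cf].
  have c2 : cabs (of_pair w) @[w --> v] --> cabs (of_pair v).
    by apply: (continuous_comp (g := @cabs R)); [exact: continuous_of_pair | exact: continuous_cabs_fun].
  have c11 := cvgM c1 c1; have c22 := cvgM c2 c2.
  by apply: cvgD; [exact: c11 | apply: cvgM; [exact: cvg_cst | exact: c22]].
have D0 : D !=set0 by exists (0, 0); rewrite /D /= expr0n /= addr0 ler01.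
have [v /set_mem Dv vmax] := compact_EVT_max D0 compact_disk cphi.
have surj w : of_pair (complex.Re (w : R[i]), complex.Im (w : R[i])) = w by case: w.
have vm w : cabs w <= 1 -> cabs (f w) ^+ 2 + e * cabs w ^+ 2 <= phi v.
  move=> hw; rewrite -(surj w); apply: vmax; apply: mem_set.
  by rewrite /D /= -cabs_sqr expr_le1 ?cabs_ge0.
have v1 : cabs (of_pair v) = 1.
  apply/eqP; rewrite eq_le DE //= leNgt; apply/negP => lt1.
  apply: (no_interior_max e0 (sf _ (DE _ Dv))).
  apply/cvg_ballP; exists (1 - cabs (of_pair v)); first by rewrite subr_gt0.
  move=> w hw; apply: vm; have := cabs_dist w (of_pair v); lra.
apply: (@le_trans _ _ (phi v)).
  by apply: le_trans (vm _ hz); rewrite lerDl mulr_ge0 ?sqr_ge0 // ltW.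
by rewrite /phi v1 expr1n mulr1 lerD2r ler_pXn2r ?nnegrE ?cabs_ge0 // fM.
Qed.

End MaximumPrinciple.

(** * Termwise differentiation of power series *)

Section BinomialRemainder.
Variable K : comNzRingType.
Implicit Types w h : K.

Definition pow_remainder w h m := (w + h) ^+ m - w ^+ m - m%:R * h * w ^+ m.-1.

Lemma pow_remainderS w h m :
  pow_remainder w h m.+1 = (w + h) * pow_remainder w h m + m%:R * h ^+ 2 * w ^+ m.-1.
Proof.
rewrite /pow_remainder; case: m => [|m] /=; first by ring.
by rewrite !exprS -!natr1; ring.
Qed.

(** The constant term cancels, so $n+1$ terms of the series are compared with $n$ terms of the
    derived one. *)
Lemma sum_pow_remainder (c : nat -> K) w h n :
  \sum_(0 <= k < n.+1) c k * (w + h) ^+ k - \sum_(0 <= k < n.+1) c k * w ^+ k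
    - (\sum_(0 <= k < n) k.+1%:R * c k.+1 * w ^+ k) * h =
  \sum_(0 <= k < n) c k.+1 * pow_remainder w h k.+1.
Proof.
rewrite !(big_nat_recl n 0) //= !expr0 opprD addrACA subrr add0r -sumrB.
rewrite mulr_suml -sumrB; apply: eq_bigr => k _; rewrite /pow_remainder /=; ring.
Qed.

End BinomialRemainder.

Section GeometricBounds.
Variable F : realFieldType.

(** Absorbs the factor $m^2$ of [pow_remainder_le] into a geometric series. The induction starts at
    3, where $(m+1)^2\le 2m^2$ is valid. *)
Lemma sqr_le_4exp2 m : (m ^ 2 <= 4 * 2 ^ m)%N.
Proof.
case: m => [|[|[|m]]] //; elim: m => [//|m IH].
have h : (m.+4 ^ 2 <= 2 * m.+3 ^ 2)%N by rewrite -!mulnn; nia.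
by apply: leq_trans h _; rewrite [in leqRHS]expnS mulnCA leq_mul2l.
Qed.

Lemma sum_half_le (n : nat) : \sum_(0 <= k < n) (2 ^+ k)^-1 <= 2 :> F.
Proof.
suff -> : \sum_(0 <= k < n) (2 ^+ k)^-1 = 2 - 2 * (2 ^+ n)^-1 :> F.
  by rewrite gerBl mulr_ge0 // invr_ge0 exprn_ge0.
elim: n => [|n IH]; first by rewrite big_geq // expr0 invr1 mulr1 subrr.
rewrite big_nat_recr //= IH exprS; field.
by rewrite expf_neq0 // pnatr_eq0.
Qed.

End GeometricBounds.

Section PowerSeries.
Variable R : realType.
Local Notation C := (Cplx R).
Implicit Types (f : C -> C) (c u : nat -> C) (p a z w h l : C) (e M t A : R).

Lemma cvg_cabsP u l : (u @ \oo --> l) <->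
  forall e, 0 < e -> exists N, forall n, (N <= n)%N -> cabs (u n - l) < e.
Proof.
split.
  move=> /cvgrPdist_lt H e e0.
  have [|N _ hN] := H (toC e); first by rewrite -toC0 toC_lt.
  by exists N => n /hN /=; rewrite normE toC_lt cabsB.
move=> H; apply/cvgrPdist_lt => e /toC_surj_gt0[x x0 ->].
have [N hN] := H x x0; exists N => // n /hN /=.
by rewrite normE toC_lt cabsB.
Qed.

Lemma cvg_cabs_le u l M : (forall n, cabs (u n) <= M) -> u @ \oo --> l ->
  cabs l <= M.
Proof.
move=> uM /cvg_cabsP ul; apply/ler_addgt0Pr => e /ul[N /(_ N (leqnn N)) h].
by have := cabs_dist l (u N); have := uM N; rewrite cabsB; lra.
Qed.

Lemma cabs_sum_nat (F : nat -> C) m n :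
  cabs (\sum_(m <= i < n) F i) <= \sum_(m <= i < n) cabs (F i).
Proof.
elim/big_ind2 : _ => [|x1 x2 y1 y2 h1 h2|//]; first by rewrite cabs0.
exact: le_trans (cabsD _ _) (lerD h1 h2).
Qed.

(** Real and imaginary parts are bounded by $|u_k|$ and converge by comparison with a geometric
    series. *)
Lemma series_dominated u A : (forall k, cabs (u k) <= A * (2 ^+ k)^-1) ->
  exists l : C, series u @ \oo --> l.
Proof.
move=> uA.
have A0 : 0 <= A.
  by have := uA 0%N; rewrite expr0 invr1 mulr1; exact: le_trans (cabs_ge0 _).
have rcv (v : nat -> R) : (forall k, `|v k| <= cabs (u k)) -> cvgn (series v).
  move=> vu; apply: (@normed_cvg R R^o); apply: (@series_le_cvg _ _ (geometric A 2^-1)).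
  - by move=> n; rewrite normr_ge0.
  - by move=> n; rewrite /= mulr_ge0 // exprn_ge0 // invr_ge0.
  - by move=> n; rewrite /= exprVn; exact: le_trans (vu n) (uA n).
  - by apply: is_cvg_geometric_series; rewrite ger0_norm // invf_lt1 // ltr1n.
have cRe : cvgn (series (fun k => complex.Re (u k : R[i]))).
  apply: rcv => k; rewrite -(ler_pXn2r (n := 2)) ?nnegrE ?cabs_ge0//.
  by rewrite real_normK ?num_real// cabs_sqr lerDl sqr_ge0.
have cIm : cvgn (series (fun k => complex.Im (u k : R[i]))).
  apply: rcv => k; rewrite -(ler_pXn2r (n := 2)) ?nnegrE ?cabs_ge0//.
  by rewrite real_normK ?num_real// cabs_sqr lerDr sqr_ge0.
exists (of_pair (limn (series (fun k => complex.Re (u k : R[i]))),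
                 limn (series (fun k => complex.Im (u k : R[i]))))).
have -> : series u = fun n => of_pair (series (fun k => complex.Re (u k : R[i])) n,
                                      series (fun k => complex.Im (u k : R[i])) n).
  apply/funext => n; rewrite /series /of_pair /=.
  elim: n => [|n IH]; first by rewrite !big_geq.
  by rewrite !big_nat_recr //= IH; case: (u n).
set s1 := series _ in cRe *; set s2 := series _ in cIm *.
have cv : (fun n => (s1 n, s2 n)) @ \oo --> (limn s1, limn s2).
  exact: (cvg_pair (FF := eventually_filter) cRe cIm).
exact: (cvg_comp (fun n => (s1 n, s2 n)) (@of_pair R) cv (@continuous_of_pair R _)).
Qed.

(** The factor [rho ^+ 2] on the left avoids the exponent $m-2$ on the right. The induction follows
    [pow_remainderS] and ends with $m^2+m\le(m+1)^2$. *)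
Lemma pow_remainder_le w h (rho : R) m : 0 < rho ->
  cabs w <= rho -> cabs (w + h) <= rho ->
  rho ^+ 2 * cabs (pow_remainder w h m) <= cabs h ^+ 2 * (m ^ 2)%:R * rho ^+ m.
Proof.
move=> r0 hw hwh; elim: m => [|m IH].
  by rewrite /pow_remainder !expr0 !mul0r subr0 subrr cabs0 !mulr0 mul0r.
rewrite pow_remainderS.
have h1 : cabs ((w + h) * pow_remainder w h m) <= rho * cabs (pow_remainder w h m).
  by rewrite cabsM ler_wpM2r ?cabs_ge0.
have h2 : rho ^+ 2 * cabs (m%:R * h ^+ 2 * w ^+ m.-1) <= m%:R * cabs h ^+ 2 * rho ^+ m.+1.
  case: m {IH h1} => [|m] /=; first by rewrite !mul0r cabs0 mulr0.
  rewrite !cabsM !cabsX -(toC_nat R) cabs_toC ger0_norm //.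
  have -> : m.+1%:R * cabs h ^+ 2 * rho ^+ m.+2 = rho ^+ 2 * (m.+1%:R * cabs h ^+ 2 * rho ^+ m).
    by rewrite !exprS; ring.
  rewrite ler_wpM2l ?sqr_ge0 //; apply: ler_wpM2l; first by apply: mulr_ge0; [exact: ler0n | exact: sqr_ge0].
  by rewrite lerXn2r ?nnegrE ?cabs_ge0 // ltW.
apply: (@le_trans _ _ (rho * (rho ^+ 2 * cabs (pow_remainder w h m)) +
   m%:R * cabs h ^+ 2 * rho ^+ m.+1)).
  apply: (@le_trans _ _ (rho ^+ 2 * (cabs ((w + h) * pow_remainder w h m) +
     cabs (m%:R * h ^+ 2 * w ^+ m.-1)))).
    by rewrite ler_wpM2l ?sqr_ge0 // cabsD.
  rewrite mulrDr; apply: lerD => //; rewrite mulrCA ler_wpM2l ?sqr_ge0 //.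
apply: (@le_trans _ _ (rho * (cabs h ^+ 2 * (m ^ 2)%:R * rho ^+ m) +
   m%:R * cabs h ^+ 2 * rho ^+ m.+1)).
  by rewrite lerD2r ler_wpM2l // ltW.
have -> : rho * (cabs h ^+ 2 * (m ^ 2)%:R * rho ^+ m) + m%:R * cabs h ^+ 2 * rho ^+ m.+1 =
  cabs h ^+ 2 * (m ^ 2 + m)%:R * rho ^+ m.+1.
  by rewrite natrD [rho ^+ m.+1]exprS; ring.
rewrite ler_wpM2r ?exprn_ge0 ?(ltW r0) // ler_wpM2l ?sqr_ge0 // ler_nat.
by rewrite -!mulnn; nia.
Qed.

End PowerSeries.

Section TermwiseDerivative.
Variable R : realType.
Local Notation C := (Cplx R).
Implicit Types (f : C -> C) (c u : nat -> C) (p a z w h l : C) (e M t A : R).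

Lemma cvg_shift1 u l : u @ \oo --> l -> (fun n => u n.+1) @ \oo --> l.
Proof.
move=> /cvg_cabsP H; apply/cvg_cabsP => e /H[N hN]; exists N => n Nn.
by apply: hN; exact: leqW.
Qed.

Definition deriv_coef c k : C := k.+1%:R * c k.+1.

Variables (c : nat -> C) (M t : R).
Hypotheses (t0 : 0 < t) (cM : forall k, cabs (c k) * t ^+ k <= M).
(** On a quarter of the radius the coefficient bound gains $4^{-k}$; the factors $k+1$ and $(k+1)^2$
    cost a multiple of $2^k$ and leave a geometric series of ratio 1/2. *)
Let rho := t / 4.
Let M0 : 0 <= M.
Proof. by apply: le_trans (cM 0); rewrite mulr_ge0 ?cabs_ge0. Qed.
Let rho0 : 0 < rho. Proof. by rewrite divr_gt0. Qed.

Lemma coef_le k : cabs (c k) * rho ^+ k <= M * (4 ^+ k)^-1.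
Proof.
rewrite /rho expr_div_n mulrA ler_wpM2r // invr_ge0 exprn_ge0 //.
Qed.

Lemma deriv_series_cvg w : cabs w <= rho ->
  exists l : C, series (fun k => deriv_coef c k * w ^+ k) @ \oo --> l.
Proof.
move=> hw; apply: (@series_dominated _ _ (M / t)) => k.
rewrite /deriv_coef !cabsM cabsX -(toC_nat R) cabs_toC ger0_norm //.
apply: (@le_trans _ _ (k.+1%:R * cabs (c k.+1) * rho ^+ k)).
  apply: ler_wpM2l; first by rewrite mulr_ge0 ?cabs_ge0.
  by rewrite lerXn2r ?nnegrE ?cabs_ge0 // ltW.
rewrite -(ler_pM2r rho0).
have -> : k.+1%:R * cabs (c k.+1) * rho ^+ k * rho = k.+1%:R * (cabs (c k.+1) * rho ^+ k.+1).
  by rewrite exprSr !mulrA.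
apply: (@le_trans _ _ ((2 ^ k)%:R * (M * (4 ^+ k.+1)^-1))).
  apply: ler_pM => //; last exact: coef_le.
    by rewrite mulr_ge0 ?cabs_ge0 // exprn_ge0 // ltW.
  by rewrite ler_nat ltn_expl.
have -> : (2 ^ k)%:R * (M * (4 ^+ k.+1)^-1) = M * (2 ^+ k)^-1 / 4.
  rewrite natrX exprSr.
  have -> : (4 : R) ^+ k = 2 ^+ k * 2 ^+ k by rewrite -exprMn; congr (_ ^+ _); ring.
  by field; rewrite expf_neq0.
have -> : M / t * (2 ^+ k)^-1 * rho = M * (2 ^+ k)^-1 / 4.
  by rewrite /rho; field; rewrite expf_neq0 //= gt_eqF.
exact: lexx.
Qed.

(** The constant 8 is the 4 of [sqr_le_4exp2] times the sum 2 of the geometric series. The bound is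
    uniform in [n], so it survives the limit in [is_derive_series]. *)
Lemma deriv_remainder_le w h n : cabs w <= rho -> cabs (w + h) <= rho ->
  cabs (\sum_(0 <= k < n) c k.+1 * pow_remainder w h k.+1) <=
  8 * M / rho ^+ 2 * cabs h ^+ 2.
Proof.
move=> hw hwh; apply: le_trans (cabs_sum_nat _ _ _) _.
have r2 : 0 < rho ^+ 2 by rewrite exprn_gt0.
have bound k : cabs (c k.+1 * pow_remainder w h k.+1) <=
    (4 * M / rho ^+ 2 * cabs h ^+ 2) * (2 ^+ k)^-1.
  rewrite cabsM -(ler_pM2l r2).
  apply: (@le_trans _ _ (cabs (c k.+1) * (cabs h ^+ 2 * (k.+1 ^ 2)%:R * rho ^+ k.+1))).
    by rewrite mulrCA ler_wpM2l ?cabs_ge0 // pow_remainder_le.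
  have -> : cabs (c k.+1) * (cabs h ^+ 2 * (k.+1 ^ 2)%:R * rho ^+ k.+1) =
    cabs h ^+ 2 * ((k.+1 ^ 2)%:R * (cabs (c k.+1) * rho ^+ k.+1)) by ring.
  have -> : rho ^+ 2 * (4 * M / rho ^+ 2 * cabs h ^+ 2 * (2 ^+ k)^-1) =
    cabs h ^+ 2 * (4 * M * (2 ^+ k)^-1).
    by field; rewrite expf_neq0 //= gt_eqF.
  rewrite ler_wpM2l ?sqr_ge0 //.
  apply: (@le_trans _ _ ((4 * 2 ^ k.+1)%:R * (M * (4 ^+ k.+1)^-1))).
    apply: ler_pM => //; last exact: coef_le.
      by rewrite mulr_ge0 ?cabs_ge0 // exprn_ge0 // ltW.
    by rewrite ler_nat sqr_le_4exp2.
  rewrite natrM natrX.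
  have -> : (4 : R) ^+ k.+1 = 2 ^+ k.+1 * 2 ^+ k.+1 by rewrite -exprMn; congr (_ ^+ _); ring.
  have -> : 4 * 2 ^+ k.+1 * (M * (2 ^+ k.+1 * 2 ^+ k.+1)^-1) = 4 * M * (2 ^+ k)^-1 / 2.
    by rewrite exprS; field; rewrite expf_neq0.
  rewrite ler_piMr ?invf_le1 ?ler1n // mulr_ge0 ?invr_ge0 ?exprn_ge0 // mulr_ge0 //.
apply: (@le_trans _ _ (\sum_(0 <= k < n) (4 * M / rho ^+ 2 * cabs h ^+ 2) * (2 ^+ k)^-1)).
  by apply: ler_sum => k _; exact: bound.
rewrite -mulr_sumr.
have -> : 8 * M / rho ^+ 2 * cabs h ^+ 2 = (4 * M / rho ^+ 2 * cabs h ^+ 2) * 2 by ring.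
apply: ler_wpM2l; last exact: sum_half_le.
by rewrite mulr_ge0 ?sqr_ge0 // mulr_ge0 ?invr_ge0 ?sqr_ge0 // mulr_ge0.
Qed.

Lemma is_derive_series f a z l :
  (forall z, cabs (z - a) < t ->
     series (fun k => c k * (z - a) ^+ k) @ \oo --> f z) ->
  cabs (z - a) < rho ->
  series (fun k => deriv_coef c k * (z - a) ^+ k) @ \oo --> l ->
  is_derive z 1 f l.
Proof.
move=> sf hz sl; apply/is_derive_cabs => e e0.
pose K := 8 * M / rho ^+ 2.
have K0 : 0 <= K by rewrite /K mulr_ge0 ?invr_ge0 ?sqr_ge0 // mulr_ge0.
have rt : rho < t by rewrite /rho ltr_pdivrMr // ltr_pMr // ltr1n.
(* The first bound keeps $z+h$ within [rho] of [a]; the second makes $K|h|^2$ at most $e|h|$. *)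
exists (Num.min (rho - cabs (z - a)) (e / (K + 1))).
  by rewrite lt_min subr_gt0 hz divr_gt0 // ltr_wpDl.
move=> h; rewrite lt_min => /andP[h1 h2].
have hzh : cabs (z - a + h) < rho.
  by apply: le_lt_trans (cabsD _ _) _; rewrite -ltrBrDl.
have zhE : z + h - a = z - a + h by rewrite addrAC.
have s1 := cvg_shift1 (sf (z + h) _); have s2 := cvg_shift1 (sf z (lt_trans hz rt)).
have {}s1 : (fun n => \sum_(0 <= k < n.+1) c k * (z - a + h) ^+ k) @ \oo --> f (z + h).
  by rewrite -zhE; apply: s1; rewrite zhE; exact: lt_trans hzh rt.
have lim := cvgB (cvgB s1 s2) (cvgM sl (cvg_cst h)).
have F : Filter \oo := eventually_filter.
apply: le_trans (@cvg_cabs_le R _ _ (K * cabs h ^+ 2) _ (lim F F F F)) _.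
  move=> n; rewrite !fctE /series /=.
  rewrite [X in cabs X](sum_pow_remainder c (z - a) h n).
  by apply: deriv_remainder_le; exact: ltW.
rewrite expr2 mulrA ler_wpM2r ?cabs_ge0 //.
move: h2; rewrite ltr_pdivlMr ?ltr_wpDl // => h2.
by have := cabs_ge0 h; nra.
Qed.

End TermwiseDerivative.

Section AnalyticSmooth.
Variable R : realType.
Local Notation C := (Cplx R).
Implicit Types (f : C -> C) (a : C).

Lemma analytic_derive f a : analytic_at f a ->
  (\forall z \near a, derivable f z 1) /\ analytic_at (derive1 f) a.
Proof.
move=> [c [r [/toC_surj_gt0[x x0 ->] H]]].
have {}H (z : C) : cabs (z - a) < x -> series (fun k => c k * (z - a) ^+ k) @ \oo --> f z.
  by move=> hz; apply: H; rewrite normE toC_lt.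
pose t := x / 2.
have t0 : 0 < t by rewrite divr_gt0.
have tx : t < x by rewrite /t ltr_pdivrMr // ltr_pMr // ltr1n.
(* The series converges at [a + toC t], so its terms tend to 0; those preceding the index from which
   they stay below 1 are summed into [M]. *)
have [M cM] : exists M, forall k, cabs (c k) * t ^+ k <= M.
  have ht : cabs (a + toC t - a) < x by rewrite [a + _]addrC addrK cabs_toC gtr0_norm.
  have := cvg_series_cvg_0 (cvgP _ (H _ ht)).
  move=> /cvg_cabsP/(_ 1 ltr01)[N hN].
  exists (1 + \sum_(i < N) cabs (c i) * t ^+ i) => k.
  have [Nk|kN] := leqP N k.
    have := hN _ Nk; rewrite subr0 [a + _]addrC addrK cabsM cabsX cabs_toC gtr0_norm //.
    move=> h; apply: le_trans (ltW h) _; rewrite lerDl sumr_ge0 // => i _.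
    by rewrite mulr_ge0 ?cabs_ge0 // exprn_ge0 // ltW.
  rewrite (bigD1 (Ordinal kN)) //= addrCA lerDl addr_ge0 // sumr_ge0 // => i _.
  by rewrite mulr_ge0 ?cabs_ge0 // exprn_ge0 // ltW.
have {}H (z : C) : cabs (z - a) < t -> series (fun k => c k * (z - a) ^+ k) @ \oo --> f z.
  by move=> /lt_trans/(_ tx); exact: H.
have D (z : C) : cabs (z - a) < t / 4 ->
    derivable f z 1 /\ series (fun k => deriv_coef c k * (z - a) ^+ k) @ \oo --> derive1 f z.
  move=> hz; have [l sl] := deriv_series_cvg t0 cM (ltW hz).
  have [df fl] := is_derive_series t0 cM H hz sl; split; first exact: df.
  have -> : derive1 f z = l := etrans (@derive1E (Cplx R) _ f z) fl.
  exact: sl.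
split.
  by apply/cvg_ballP; exists (t / 4); [rewrite divr_gt0 | move=> z /D[]].
exists (deriv_coef c), (toC (t / 4)); split.
  by rewrite -toC0 toC_lt divr_gt0.
by move=> z; rewrite normE toC_lt => /D[].
Qed.

Lemma analytic_smooth f a k : analytic_at f a -> smooth k f a.
Proof.
elim: k f => [//|k IH] f /analytic_derive[df af]; split => //; exact: IH.
Qed.

End AnalyticSmooth.

(** * Poisson sums over zeros *)

Section FactorZeros.
Variables (K : numFieldType) (n : nat) (D : K -> Prop) (k : K -> nat).
Implicit Types (W V F : K -> K) (s : seq K).

Lemma near_neq (p a : K) : p != a -> \forall z \near p, z != a.
Proof.
move=> pa; have h : {for p, continuous (fun z : K => z - a)}.
  by apply: smooth_continuous (smoothB (smooth_id 1 p) (smooth_cst 1 a p)).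
have pa0 : p - a != 0 by rewrite subr_eq0.
have : \forall z \near p, z - a != 0 by exact: cvgr_neq0 h pa0.
by apply: filterS => z; rewrite subr_eq0.
Qed.

Lemma smooth_factor m a p : smooth m (fun z : K => (z - a) ^+ k a) p.
Proof. exact: smoothX (smoothB (smooth_id _ _) (smooth_cst _ _ _)). Qed.

(** Zeros are divided out one at a time. The quotient is smooth away from [a] and agrees with the
    local cofactor near [a]; the local factorization at any other point [b] passes to the quotient
    because $(z-a)^{k(a)}$ does not vanish at [b]. *)
Lemma factor_zeros s W : uniq s -> (forall p, D p -> smooth n W p) ->
  (forall a, a \in s -> exists V, smooth n V a /\
     \forall z \near a, W z = (z - a) ^+ k a * V z) ->
  exists F, (forall p, D p -> smooth n F p) /\
    forall z, W z = (\prod_(a <- s) (z - a) ^+ k a) * F z.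
Proof.
elim: s W => [|a s IH] W.
  by move=> _ sW _; exists W; split=> // z; rewrite big_nil mul1r.
move=> /= /andP[aNs us] sW loc.
have [Va [sVa hVa]] := loc a (mem_head _ _).
pose V z := if z == a then Va a else W z / (z - a) ^+ k a.
have Vaa : \forall z \near a, Va z = V z.
  apply: filterS hVa => z; rewrite /V; have [->//|za ->] := eqVneq z a.
  by rewrite mulrC mulKf // expf_neq0 // subr_eq0.
have Vne p : p != a -> \forall z \near p, W z / (z - a) ^+ k a = V z.
  by move=> pa; apply: filterS (near_neq pa) => z; rewrite /V => /negPf ->.
have WV z : W z = (z - a) ^+ k a * V z.
  rewrite /V; have [->|za] := eqVneq z a; first exact: nbhs_singleton hVa.
  by rewrite mulrC divfK // expf_neq0 // subr_eq0.
have sV p : D p -> smooth n V p.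
  move=> Dp; have [->|pa] := eqVneq p a; first exact: smooth_near Vaa sVa.
  apply: smooth_near (Vne p pa) _; apply: smoothM (sW _ Dp) _.
  by apply: smoothV; [rewrite expf_neq0 // subr_eq0 | exact: smooth_factor].
have [|F [sF hF]] := IH V us sV.
  move=> b bs; have [Vb [sVb hVb]] := loc b (mem_behead (s := a :: s) bs).
  have ba : b != a by apply: contraNneq aNs => <-.
  exists (fun z => Vb z / (z - a) ^+ k a); split.
    apply: smoothM sVb _.
    by apply: smoothV; [rewrite expf_neq0 // subr_eq0 | exact: smooth_factor].
  by apply: filterS2 (Vne b ba) hVb => z <- ->; rewrite mulrA.
by exists F; split=> // z; rewrite WV hF big_cons mulrA.
Qed.

End FactorZeros.

(** * Inequalities for products, Blaschke factors and the majorant *)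

Section ProductInequality.
Variable F : realFieldType.

Lemma pow_one_minus_le (x : F) m : 0 <= x <= 1 -> (1 - x) ^+ m * (1 + m%:R * x) <= 1.
Proof.
move=> /andP[x0 x1]; elim: m => [|m IH]; first by rewrite expr0 mul0r addr0 mul1r.
apply: le_trans IH; rewrite exprSr -mulrA ler_wpM2l ?exprn_ge0 ?subr_ge0 //.
rewrite -natr1; have : 0 <= m%:R * x * x by rewrite !mulr_ge0.
by have := mulr_ge0 x0 x0; lra.
Qed.

(** Takes the place of logarithms: a lower bound for the product becomes an upper bound for the sum.
    The induction uses $(1+u)(1+S)\ge 1+u+S$. *)
Lemma prod_one_minus_le (T : eqType) (s : seq T) (x : T -> F) (k : T -> nat) :
  (forall a, a \in s -> 0 <= x a <= 1) ->
  (\prod_(a <- s) (1 - x a) ^+ k a) * (1 + \sum_(a <- s) (k a)%:R * x a) <= 1.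
Proof.
elim: s => [|a s IH] hx; first by rewrite !big_nil addr0 mul1r.
have hxs b : b \in s -> 0 <= x b <= 1 by move=> bs; apply: hx; rewrite inE bs orbT.
have {}IH := IH hxs.
have ha := hx a (mem_head _ _); have /andP[a0 a1] := ha.
have P0 : 0 <= \prod_(b <- s) (1 - x b) ^+ k b.
  rewrite big_seq prodr_ge0 // => b /hxs /andP[_ ?]; by rewrite exprn_ge0 // subr_ge0.
have S0 : 0 <= \sum_(b <- s) (k b)%:R * x b.
  by rewrite big_seq sumr_ge0 // => b /hxs /andP[? _]; rewrite mulr_ge0.
rewrite !big_cons.
set P := \prod_(b <- s) _ in P0 IH *; set S := \sum_(b <- s) _ in S0 IH *.
have q0 : 0 <= (1 - x a) ^+ k a by rewrite exprn_ge0 // subr_ge0.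
have ka0 : 0 <= (k a)%:R * x a by rewrite mulr_ge0.
apply: (@le_trans _ _ (((1 - x a) ^+ k a * (1 + (k a)%:R * x a)) * (P * (1 + S)))).
  rewrite [leRHS]mulrACA ler_wpM2l ?mulr_ge0 //.
  by have := mulr_ge0 ka0 S0; lra.
rewrite mulr_ile1 ?pow_one_minus_le // mulr_ge0 ?addr_ge0 //.
Qed.

End ProductInequality.

Section PoissonSum.
Variable R : realType.
Local Notation C := (Cplx R).
Implicit Types (a z w xi zeta : C) (A M rho : R).

Definition poisson a zeta : R := (1 - cabs a ^+ 2) / cabs (zeta - a) ^+ 2.

Lemma blaschke_identity a z :
  cabs (1 - cplx_conj a * z) ^+ 2 - cabs (z - a) ^+ 2 =
  (1 - cabs z ^+ 2) * (1 - cabs a ^+ 2).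
Proof. by rewrite !cabs_sqr; case: a z => [x y] [u v] /=; ring. Qed.

Lemma cabs_factor_circle a zeta : cabs zeta = 1 ->
  cabs (1 - cplx_conj a * zeta) = cabs (zeta - a).
Proof.
move=> z1; have := blaschke_identity a zeta.
rewrite z1 expr1n subrr mul0r => /eqP; rewrite subr_eq0 => /eqP h.
by apply: (pexpIrn (n := 2)); rewrite ?nnegrE ?cabs_ge0.
Qed.

Lemma factor_neq0 a z : cabs a < 1 -> cabs z <= 1 -> 1 - cplx_conj a * z != 0.
Proof.
move=> a1 z1; rewrite -cabs_gt0.
apply: (@lt_le_trans _ _ (cabs 1 - cabs (cplx_conj a * z))); last exact: cabs_dist.
rewrite cabs1 cabsM cabs_conj subr_gt0.
by have := cabs_ge0 a; have := cabs_ge0 z; nra.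
Qed.

(* A nonvanishing substitute for [1 + |w - zeta| / rho]. *)
Definition majorant zeta rho w : C := 1 + (1 - cplx_conj zeta * w) * toC rho^-1.

(** The number $u=1-\overline{\zeta}w$ has nonnegative real part and modulus $|w-\zeta|$, so
    $|1+u/\rho|^2\ge 1+y^2$ with $y=|u|/\rho$, and $(1+y)^2\le 4(1+y^2)$. *)
Lemma majorant_ge zeta rho w : 0 < rho -> cabs zeta = 1 -> cabs w <= 1 ->
  1 + cabs (w - zeta) / rho <= 2 * cabs (majorant zeta rho w).
Proof.
move=> r0 z1 w1.
have Re0 : complex.Re (cplx_conj zeta * w : R[i]) <= 1.
  by apply: le_trans (Re_le_cabs _) _; rewrite cabsM cabs_conj z1 mul1r.
have uE : cabs (1 - cplx_conj zeta * w) = cabs (w - zeta).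
  have <- : cplx_conj zeta * (zeta - w) = 1 - cplx_conj zeta * w.
    by rewrite mulrBr; congr (_ - _); rewrite mulrC mul_conj z1 expr1n.
  by rewrite cabsM cabs_conj z1 mul1r cabsB.
rewrite -uE.
have A0 : 0 <= 1 + cabs (1 - cplx_conj zeta * w) / rho.
  by rewrite addr_ge0 // divr_ge0 ?cabs_ge0 // ltW.
have B0 : 0 <= 2 * cabs (majorant zeta rho w) by rewrite mulr_ge0 ?cabs_ge0.
rewrite -(ler_pXn2r (n := 2)) ?nnegrE //.
have : 0 <= complex.Re (1 - cplx_conj zeta * w : R[i]).
  by move: Re0; case: (cplx_conj zeta * w) => x y /=; rewrite subr_ge0.
rewrite /majorant {A0 B0 uE}; move: (1 - _) => u u0.
have mE : cabs (1 + u * toC rho^-1) ^+ 2 =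
    1 + 2 * (complex.Re (u : R[i]) / rho) + (cabs u / rho) ^+ 2.
  rewrite !cabs_sqr [in RHS]expr_div_n cabs_sqr.
  by case: (u) => x y; rewrite /toC /=; field; rewrite gt_eqF.
rewrite [leRHS]exprMn mE.
have : 0 <= complex.Re (u : R[i]) / rho by rewrite divr_ge0 // ltW.
move: (complex.Re _ / rho) (cabs u / rho) => x y x0.
by have := sqr_ge0 (1 - y); have := sqr_ge0 y; rewrite !expr2; lra.
Qed.

End PoissonSum.

(** * The weighted Poisson sum at one point of the circle *)

Section KeyEstimate.
Variable R : realType.
Local Notation C := (Cplx R).
Implicit Types (a z w xi zeta : C) (A M rho : R) (W F : C -> C).

Lemma majorant_radial zeta rho : 0 < rho -> cabs zeta = 1 ->
  cabs (majorant zeta rho (toC (1 - rho / 2) * zeta)) = 3 / 2.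
Proof.
move=> r0 z1; have -> : majorant zeta rho (toC (1 - rho / 2) * zeta) = toC (3 / 2).
  rewrite /majorant mulrCA [_ * zeta]mulrC mul_conj z1 expr1n toC1 mulr1.
  rewrite -toC1 -toCB -toCM -toCD; congr toC; field; exact: lt0r_neq0.
by rewrite cabs_toC ger0_norm // divr_ge0.
Qed.

Lemma disk_segment z w (t : R) : cabs z <= 1 -> cabs w <= 1 -> 0 <= t <= 1 ->
  cabs (z + toC t * (w - z)) <= 1.
Proof.
move=> hz hw /andP[t0 t1].
have -> : z + toC t * (w - z) = toC (1 - t) * z + toC t * w.
  by rewrite toCB toC1; move: (toC t) => u; ring.
apply: le_trans (cabsD _ _) _; rewrite !cabsM !cabs_toC !ger0_norm ?subr_ge0 //.
have := cabs_ge0 z; have := cabs_ge0 w; nra.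
Qed.

(** The maximum principle carries the bound on $W'$ from the circle into the disk. It asks for
    [smooth 2] of $W'$, which is why [W] is taken smooth of order 3. *)
Lemma disk_lipschitz W M : (forall p, cabs p <= 1 -> smooth 3 W p) ->
  (forall zeta, cabs zeta = 1 -> cabs (derive1 W zeta) <= M) ->
  forall z w, cabs z <= 1 -> cabs w <= 1 -> cabs (W z - W w) <= M * cabs (z - w).
Proof.
move=> sW dW z w hz hw.
have dM p : cabs p <= 1 -> cabs (derive1 W p) <= M.
  by apply: maximum_principle dW p => p /sW[].
apply: segment_mean_value => t ht; have hp := disk_segment hw hz ht.
by split; [exact: smooth_derivable (sW _ hp) | exact: dM].
Qed.

Variables (W : C -> C) (s : seq C) (k : C -> nat) (A M : R) (zeta : C).
Hypotheses (us : uniq s) (s1 : forall a, a \in s -> cabs a < 1)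
  (sW : forall p, cabs p <= 1 -> smooth 3 W p)
  (loc : forall a, a \in s -> exists V, smooth 3 V a /\
     \forall z \near a, W z = (z - a) ^+ k a * V z)
  (zeta1 : cabs zeta = 1) (A0 : 0 < A) (M0 : 0 < M)
  (hA : 1 <= A * cabs (W zeta))
  (lip : forall z w, cabs z <= 1 -> cabs w <= 1 -> cabs (W z - W w) <= M * cabs (z - w)).

Let rho := (A * M)^-1.
Let rho0 : 0 < rho. Proof. by rewrite invr_gt0 mulr_gt0. Qed.
Let AMrho : A * M * rho = 1. Proof. by rewrite mulfV // gt_eqF // mulr_gt0. Qed.

(** Because $W(a)=0$, one has $1\le A|W(\zeta)-W(a)|\le AM|\zeta-a|$. *)
Lemma zero_distance a : a \in s -> k a != 0%N -> rho <= cabs (zeta - a).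
Proof.
move=> asn ka; have [V [_ hV]] := loc asn.
have Wa : W a = 0.
  have -> := nbhs_singleton hV.
  by rewrite subrr expr0n (negPf ka) mul0r.
have := @lip zeta a; rewrite zeta1 => /(_ (lexx _) (ltW (s1 asn))).
rewrite Wa subr0 => h.
rewrite -(ler_pM2l (mulr_gt0 A0 M0)) AMrho; apply: le_trans hA _.
by rewrite -mulrA ler_wpM2l // ltW.
Qed.

Hypothesis rho2 : rho <= 2.

(** Close enough to [zeta] for $|W(z_0)|\ge|W(\zeta)|/2$, and deep enough in the disk for
    $1-|z_0|^2\ge\rho/2$; the latter uses [rho2]. *)
Let z0 : C := toC (1 - rho / 2) * zeta.

Let cz0 : cabs z0 = 1 - rho / 2.
Proof.
rewrite /z0 cabsM cabs_toC zeta1 mulr1 ger0_norm // subr_ge0.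
by rewrite ler_pdivrMr // mul1r.
Qed.

Let z0_le1 : cabs z0 <= 1.
Proof. by rewrite cz0 gerBl divr_ge0 // ltW. Qed.

Let dist0 : cabs (zeta - z0) = rho / 2.
Proof.
rewrite /z0; have -> : zeta - toC (1 - rho / 2) * zeta = toC (rho / 2) * zeta.
  by rewrite toCB toC1; move: (toC _) => u; ring.
by rewrite cabsM cabs_toC zeta1 mulr1 ger0_norm // divr_ge0 // ltW.
Qed.

(** This is $|b(z_0)|\ge 1/6$ cleared of denominators. The 6 is the product of the bound 2 for [Phi]
    relative to $|W(\zeta)|$, the value 3/2 of the majorant at $z_0$, and the 2 in $|W(\zeta)|\le
    2|W(z_0)|$. *)
Lemma blaschke_lower_bound :
  \prod_(a <- s) cabs (1 - cplx_conj a * z0) ^+ k a <=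
  6 * \prod_(a <- s) cabs (z0 - a) ^+ k a.
Proof.
have [F [sF WF]] := factor_zeros (n := 3) (D := fun p => cabs p <= 1) us sW loc.
pose Q (w : C) := \prod_(a <- s) (1 - cplx_conj a * w) ^+ k a.
(* [F w * Q w] is $W/b$ with the zeros cancelled, hence smooth on the whole closed disk. *)
pose Phi (w : C) := F w * Q w * (majorant zeta rho w)^-1.
have cQ w : cabs (Q w) = \prod_(a <- s) cabs (1 - cplx_conj a * w) ^+ k a.
  by rewrite /Q cabs_prod; apply: eq_bigr => a _; rewrite cabsX.
have cW w : cabs (W w) = (\prod_(a <- s) cabs (w - a) ^+ k a) * cabs (F w).
  by rewrite WF cabsM cabs_prod; congr (_ * _); apply: eq_bigr => a _; rewrite cabsX.
have H0 w : cabs w <= 1 -> 0 < cabs (majorant zeta rho w).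
  move=> hw; have := majorant_ge rho0 zeta1 hw.
  have : 0 <= cabs (w - zeta) / rho by rewrite divr_ge0 ?cabs_ge0 // ltW.
  lra.
have sPhi w : cabs w <= 1 -> smooth 2 Phi w.
  move=> hw; have sf := smoothW (sF w hw).
  apply: smoothM; first apply: smoothM sf _.
    apply: smooth_prod => a _; apply: smoothX; apply: smoothB; first exact: smooth_cst.
    by apply: smoothM; [exact: smooth_cst | exact: smooth_id].
  apply: smoothV; first by rewrite -cabs_gt0 H0.
  apply: smoothD; first exact: smooth_cst.
  apply: smoothM; last exact: smooth_cst.
  apply: smoothB; first exact: smooth_cst.
  by apply: smoothM; [exact: smooth_cst | exact: smooth_id].
have hPhi w : cabs w = 1 -> cabs (Phi w) <= 2 * cabs (W zeta).
  move=> w1; rewrite /Phi !cabsM cabsV ler_pdivrMr ?H0 ?w1 //.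
  have -> : cabs (F w) * cabs (Q w) = cabs (W w).
    rewrite cW cQ mulrC; congr (_ * _); apply: eq_bigr => a _.
    by rewrite cabs_factor_circle.
  apply: (@le_trans _ _ (cabs (W zeta) * (1 + cabs (w - zeta) / rho))).
    have h1 : cabs (W w) - cabs (W zeta) <= M * cabs (w - zeta).
      by apply: le_trans (cabs_dist _ _) _; apply: lip; rewrite ?w1 ?zeta1.
    (* Here $M\rho=1/A\le|W(\zeta)|$. *)
    have h2 : M * cabs (w - zeta) <= cabs (W zeta) * (cabs (w - zeta) / rho).
      rewrite [leRHS]mulrCA [leRHS]mulrC ler_wpM2r ?cabs_ge0 //.
      by rewrite ler_pdivlMr // -(ler_pM2l A0) mulrA AMrho.
    by move: h1 h2; lra.
  have := majorant_ge rho0 zeta1 (_ : cabs w <= 1); rewrite w1 => /(_ (lexx _)) h.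
  rewrite [leRHS]mulrAC mulrC ler_wpM2r ?cabs_ge0 //.
have := maximum_principle sPhi hPhi z0_le1.
rewrite /Phi !cabsM cabsV majorant_radial // ler_pdivrMr //.
have Wz0 : cabs (W zeta) <= 2 * cabs (W z0).
  have h1 := cabs_dist (W zeta) (W z0).
  have h2 := @lip zeta z0; rewrite zeta1 dist0 in h2.
  have {}h2 := h2 (lexx _) z0_le1.
  have h3 : M * (rho / 2) <= cabs (W zeta) / 2.
    rewrite mulrA ler_pM2r ?invr_gt0 // -(ler_pM2l A0) mulrA AMrho; exact: hA.
  lra.
have Wz0_gt0 : 0 < cabs (W z0).
  have : 0 < cabs (W zeta).
    rewrite lt_neqAle cabs_ge0 andbT eq_sym; apply: contraTneq hA => ->.
    by rewrite mulr0 -ltNge.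
  by move: Wz0; lra.
move: Wz0 Wz0_gt0; rewrite (cW z0) cQ.
set P := \prod_(a <- s) cabs (z0 - a) ^+ k a.
set Q0 := \prod_(a <- s) cabs (1 - _) ^+ k a.
move: (cabs (F z0)) (cabs_ge0 (F z0)) (cabs (W zeta)) => f f0 w h1 h2 h3.
have fp : 0 < f.
  rewrite lt_neqAle f0 andbT eq_sym; apply: contraTneq h2 => ->.
  by rewrite mulr0 ltxx.
rewrite -(ler_pM2l fp); lra.
Qed.

Lemma poisson_sum_le_aux :
  \sum_(a <- s) (k a)%:R * poisson a zeta <= 158 * (A * M).
Proof.
(* By [blaschke_identity], $1-x_a$ is the squared modulus at $z_0$ of the Blaschke factor of [a]. *)
pose x a : R := (1 - cabs z0 ^+ 2) * (1 - cabs a ^+ 2) / cabs (1 - cplx_conj a * z0) ^+ 2.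
have Q0 a : a \in s -> 0 < cabs (1 - cplx_conj a * z0).
  by move=> /s1 a1; rewrite cabs_gt0 factor_neq0.
have xE a : a \in s -> 1 - x a = (cabs (z0 - a) / cabs (1 - cplx_conj a * z0)) ^+ 2.
  move=> /Q0 q0; rewrite /x -blaschke_identity expr_div_n; field.
  by rewrite gt_eqF.
have z01 : 0 <= 1 - cabs z0 ^+ 2.
  by rewrite subr_ge0 expr_le1 ?cabs_ge0.
have pa a : a \in s -> 0 <= 1 - cabs a ^+ 2.
  by move=> /s1/ltW a1; rewrite subr_ge0 expr_le1 ?cabs_ge0.
have x01 a : a \in s -> 0 <= x a <= 1.
  move=> asn; apply/andP; split.
    by rewrite /x divr_ge0 ?sqr_ge0 // mulr_ge0 // pa.
  by rewrite -subr_ge0 xE // sqr_ge0.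
have := prod_one_minus_le k x01.
have -> : \prod_(a <- s) (1 - x a) ^+ k a =
    (\prod_(a <- s) cabs (z0 - a) ^+ k a / \prod_(a <- s) cabs (1 - cplx_conj a * z0) ^+ k a) ^+ 2.
  rewrite -prodf_div -prodrXl big_seq [RHS]big_seq; apply: eq_bigr => a asn.
  by rewrite xE // -expr_div_n -!exprM mulnC.
have P0 : 0 <= \prod_(a <- s) cabs (z0 - a) ^+ k a.
  by rewrite prodr_ge0 // => a _; rewrite exprn_ge0 // cabs_ge0.
have Q1 : 0 < \prod_(a <- s) cabs (1 - cplx_conj a * z0) ^+ k a.
  by rewrite big_seq prodr_gt0 // => a asn; rewrite exprn_gt0 // Q0.
have := blaschke_lower_bound.
move: (\prod_(a <- s) _) P0 (\prod_(a <- s) _) Q1 => P P0 Q Q1 QP.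
have {}QP : 1 / 6 <= P / Q.
  by rewrite ler_pdivlMr // mulrC mulrA mulr1 ler_pdivrMr // mulrC.
have S0 : 0 <= \sum_(a <- s) (k a)%:R * x a.
  by rewrite big_seq sumr_ge0 // => a asn; rewrite mulr_ge0 //; case/andP: (x01 a asn).
(* The product of the $(1-x_a)^{k(a)}$ is at least 1/36, whence $1+\sum k(a)x_a\le 36$. *)
move=> h35; have {h35}h35 : \sum_(a <- s) (k a)%:R * x a <= 35.
  have : (1 / 6) ^+ 2 * (1 + \sum_(a <- s) (k a)%:R * x a) <= 1.
    apply: le_trans h35; rewrite ler_wpM2r ?addr_ge0 //.
    by rewrite lerXn2r ?nnegrE ?divr_ge0 // ltW.
  move: (\sum_(a <- s) _) => S; rewrite !expr2; lra.
(* The constant combines $1-|z_0|^2\ge\rho/2$ with $|1-\overline{a}z_0|\le\frac32|\zeta-a|$, the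
   latter from $\rho\le|\zeta-a|$: $(\rho/2)/(9/4)=2\rho/9$. *)
have key a : a \in s -> (k a)%:R * poisson a zeta * (2 * rho / 9) <= (k a)%:R * x a.
  move=> asn; have [->|ka] := eqVneq (k a) 0%N; first by rewrite !mul0r.
  rewrite -mulrA ler_wpM2l // /poisson /x.
  have d0 := zero_distance asn ka.
  have dp : 0 < cabs (zeta - a) := lt_le_trans rho0 d0.
  have qle : cabs (1 - cplx_conj a * z0) <= 3 / 2 * cabs (zeta - a).
    have -> : 1 - cplx_conj a * z0 = (1 - cplx_conj a * zeta) + cplx_conj a * (zeta - z0).
      by rewrite mulrBr addrA subrK.
    apply: le_trans (cabsD _ _) _; rewrite cabs_factor_circle // cabsM cabs_conj dist0.
    have := s1 asn; have := cabs_ge0 a; have := rho0; nra.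
  have q0 := Q0 a asn.
  have -> : (1 - cabs a ^+ 2) / cabs (zeta - a) ^+ 2 * (2 * rho / 9) =
    (1 - cabs a ^+ 2) * (2 * rho / 9 / cabs (zeta - a) ^+ 2) by ring.
  have -> : (1 - cabs z0 ^+ 2) * (1 - cabs a ^+ 2) / cabs (1 - cplx_conj a * z0) ^+ 2 =
    (1 - cabs a ^+ 2) * ((1 - cabs z0 ^+ 2) / cabs (1 - cplx_conj a * z0) ^+ 2) by ring.
  rewrite ler_wpM2l ?pa //.
  rewrite ler_pdivlMr ?exprn_gt0 // mulrAC ler_pdivrMr ?exprn_gt0 //.
  apply: (@le_trans _ _ (2 * rho / 9 * (3 / 2 * cabs (zeta - a)) ^+ 2)).
    apply: ler_wpM2l; first by rewrite ltW // divr_gt0 // mulr_gt0.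
    by rewrite lerXn2r ?nnegrE ?cabs_ge0 ?mulr_ge0 ?cabs_ge0 //.
  rewrite exprMn mulrA ler_wpM2r ?sqr_ge0 // cz0.
  by have := rho0; have := rho2; rewrite !expr2; nra.
have : (\sum_(a <- s) (k a)%:R * poisson a zeta) * (2 * rho / 9) <= 35.
  apply: le_trans h35; rewrite mulr_suml big_seq [leRHS]big_seq.
  exact: ler_sum.
have p0 : 0 < 2 * rho / 9 by rewrite divr_gt0 // mulr_gt0.
rewrite -ler_pdivlMr // => /le_trans; apply.
(* The constant 158 rounds up $35\cdot 9/2=157.5$. *)
rewrite ler_pdivrMr //.
have -> : 158 * (A * M) * (2 * rho / 9) = 158 * 2 / 9 * (A * M * rho) by ring.
by rewrite AMrho; lra.
Qed.

End KeyEstimate.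

Section PoissonSumBound.
Variable R : realType.
Local Notation C := (Cplx R).

(** Lifts two restrictions of [poisson_sum_le_aux]. Since [M] may be 0, it is enlarged by an amount
    that costs only [e] in the bound. If some $k(a)\ne 0$, then $\rho\le|\zeta-a|<2$; otherwise the
    sum is 0. *)
Lemma poisson_sum_le (W : C -> C) (s : seq C) (k : C -> nat) (A M : R) :
  uniq s -> (forall a, a \in s -> cabs a < 1) ->
  (forall p, cabs p <= 1 -> smooth 3 W p) ->
  (forall a, a \in s -> exists V, smooth 3 V a /\
     \forall z \near a, W z = (z - a) ^+ k a * V z) ->
  0 < A ->
  (forall zeta, cabs zeta = 1 -> 1 <= A * cabs (W zeta)) ->
  (forall zeta, cabs zeta = 1 -> cabs (derive1 W zeta) <= M) ->
  forall zeta, cabs zeta = 1 ->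
    \sum_(a <- s) (k a)%:R * poisson a zeta <= 158 * (A * M).
Proof.
move=> us s1 sW loc A0 hA dM zeta zeta1.
have M0 : 0 <= M := le_trans (cabs_ge0 _) (dM _ zeta1).
apply/ler_addgt0Pr => e e0.
have M'0 : 0 < M + e / (158 * A) by rewrite ltr_wpDl // divr_gt0 // mulr_gt0.
have -> : 158 * (A * M) + e = 158 * (A * (M + e / (158 * A))).
  by field; rewrite gt_eqF.
move: (M + _) M'0 (lerDl M (e / (158 * A))) => M' M'0.
have -> : 0 <= e / (158 * A) by rewrite divr_ge0 ?mulr_ge0 // ltW.
move=> MM'.
have [k0|] := boolP (all (fun a => k a == 0%N) s).
  rewrite big_seq big1 ?mulr_ge0 ?(ltW A0) ?(ltW M'0) // => a /(allP k0)/eqP ->.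
  by rewrite mul0r.
rewrite -has_predC => /hasP[a asn ka].
have lip z w : cabs z <= 1 -> cabs w <= 1 -> cabs (W z - W w) <= M' * cabs (z - w).
  move=> hz hw; apply: le_trans (disk_lipschitz sW dM hz hw) _.
  by rewrite ler_wpM2r ?cabs_ge0.
apply: (poisson_sum_le_aux us s1 sW loc zeta1 A0 M'0 (hA _ zeta1) lip).
apply: le_trans (zero_distance s1 loc zeta1 A0 M'0 (hA _ zeta1) lip asn ka) _.
have := cabsD zeta (- a); rewrite cabsN zeta1; have := s1 a asn; lra.
Qed.
End PoissonSumBound.

(** * Zeros of the Wronskian *)

Section WronskianFactor.
Variable K : numFieldType.
Implicit Types (f g V : K -> K) (a p z : K).

Lemma near_forall (I : finType) (P : I -> K -> Prop) p :
  (forall i, \forall z \near p, P i z) -> \forall z \near p, forall i, P i z.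
Proof. exact: (@filter_forall K I P (nbhs p) (nbhs_filter p)). Qed.

Definition smooth_all f p := forall k, smooth k f p.

Lemma smooth_derive1n f p i : smooth_all f p -> smooth_all (derive1n i f) p.
Proof.
by elim: i f => [//|i IH] f sf; rewrite derive1Sn; apply: IH => k; case: (sf k.+1).
Qed.

Lemma near_derivable f p : smooth_all f p -> \forall z \near p, derivable f z 1.
Proof. by move=> sf; case: (sf 1%N). Qed.

(** The conditional covers $e=0$, where the derivative is $g'$ itself; one formula with the
    truncated [e.-1] then matches [m - i] in [derive1n_factor]. *)
Lemma derive1_pow_mul a e g z : derivable g z 1 ->
  derive1 (fun z => (z - a) ^+ e * g z) z =
  (z - a) ^+ e.-1 * (e%:R * g z + (if e is 0%N then 1 else z - a) * derive1 g z).
Proof.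
move=> /derivableP dg; rewrite derive1E.
have dpow : is_derive z (1 : K) (fun z : K => (z - a) ^+ e) (e%:R * (z - a) ^+ e.-1).
  have -> : (fun z : K => (z - a) ^+ e) = (fun z : K => z - a) ^+ e.
    by rewrite exprfctE.
  apply: is_derive_eq; rewrite subr0 -![_ *: _]/(_ * _) mulr1.
  by [].
have -> : 'D_1 (fun z0 : K => (z0 - a) ^+ e * g z0) z =
    (z - a) ^+ e * 'D_1 g z + g z * (e%:R * (z - a) ^+ e.-1).
  exact: (@derive_val _ _ _ _ _ _ _ (is_deriveM dpow dg)).
rewrite derive1E; case: e {dpow} => [|e] /=; first by rewrite expr0; ring.
by rewrite exprS; ring.
Qed.

Lemma derive1n_factor f a m g : smooth_all g a ->
  (\forall z \near a, f z = (z - a) ^+ m * g z) ->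
  forall i, exists gi, smooth_all gi a /\
    \forall z \near a, derive1n i f z = (z - a) ^+ (m - i) * gi z.
Proof.
move=> sg fg; elim=> [|i [gi [sgi IH]]]; first by exists g; rewrite subn0.
exists (fun z => (m - i)%:R * gi z +
  (if (m - i)%N is 0%N then 1 else z - a) * derive1 gi z); split.
  move=> k; apply: smoothD; first exact: smoothM (smooth_cst _ _ _) (sgi k).
  apply: smoothM; last by case: (sgi k.+1).
  case: (m - i)%N => [|d]; first exact: smooth_cst.
  exact: smoothB (smooth_id _ _) (smooth_cst _ _ _).
have := near_eq_derive1 IH; rewrite -derive1nS subnS.
apply: filterS2 (near_derivable sgi) => z dg ->.
exact: derive1_pow_mul.
Qed.

Lemma derive1n_sum n (f : 'I_n -> K -> K) p i : (forall j, smooth_all (f j) p) ->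
  \forall z \near p, derive1n i (fun z => \sum_j f j z) z = \sum_j derive1n i (f j) z.
Proof.
move=> sf; elim: i => [|i IH]; first by apply: nbhsT.
have := near_eq_derive1 IH; rewrite -derive1nS.
have : \forall z \near p, forall j, derivable (derive1n i (f j)) z 1.
  by apply: near_forall => j; apply: near_derivable; exact: smooth_derive1n.
apply: filterS2 => z dz ->; rewrite derive1E.
have -> : (fun z => \sum_j derive1n i (f j) z) = \sum_j derive1n i (f j).
  by apply/funext => w; rewrite fct_sumE.
by rewrite derive_sum //; apply: eq_bigr => j _; rewrite derive1nS derive1E.
Qed.

Lemma smooth_wronskian n (f : 'I_n -> K -> K) p :
  (forall j, smooth_all (f j) p) -> smooth_all (wronskian f) p.
Proof.
move=> sf k; apply: smooth_det => i j.
apply: smooth_near (smooth_derive1n i (sf j) k).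
by apply: nbhsT => z; rewrite mxE.
Qed.

(** Row $i\le n$ of column [j] carries $(z-a)^{m-i}$, of exponent at least $m-n$; the excess powers
    and the cofactors of the expansion make up [V]. Truncated subtraction covers $m<n$. *)
Lemma wronskian_factor n (f : 'I_n.+1 -> K -> K) a j m g :
  (forall j, smooth_all (f j) a) -> smooth_all g a ->
  (\forall z \near a, f j z = (z - a) ^+ m * g z) ->
  exists V, smooth_all V a /\
    \forall z \near a, wronskian f z = (z - a) ^+ (m - n) * V z.
Proof.
move=> sf sg fg.
have [G hG] : exists G : 'I_n.+1 -> K -> K, forall i, smooth_all (G i) a /\
    \forall z \near a, derive1n i (f j) z = (z - a) ^+ (m - i) * G i z.
  have := derive1n_factor sg fg => H.
  by have [G hG] := choice H; exists (fun i => G i).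
pose Wm z := \matrix_(i < n.+1, j < n.+1) derive1n i (f j) z.
exists (fun z => \sum_(i < n.+1) ((z - a) ^+ (m - i - (m - n)) * G i z) *
   cofactor (Wm z) i j); split.
  move=> k; apply: smooth_sum => i; apply: smoothM.
    apply: smoothM; last by case: (hG i).
    exact: smoothX (smoothB (smooth_id _ _) (smooth_cst _ _ _)).
  rewrite /cofactor; apply: smoothM; first exact: smooth_cst.
  apply: smooth_det => i' j'.
  apply: smooth_near (smooth_derive1n (lift i i') (sf (lift j j')) k).
  by apply: nbhsT => z; rewrite !mxE.
have : \forall z \near a, forall i : 'I_n.+1,
    derive1n i (f j) z = (z - a) ^+ (m - i) * G i z.
  by apply: near_forall => i; case: (hG i).
apply: filterS => z hz; rewrite /wronskian (expand_det_col _ j) mulr_sumr.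
apply: eq_bigr => i _; rewrite mxE hz !mulrA -exprD.
by rewrite [in RHS]subnKC // leq_sub2l // -ltnS ltn_ord.
Qed.

(** Adding all columns to the first is right multiplication by [T], which is lower triangular with
    unit diagonal. *)
Lemma wronskian_replace0 n (f : 'I_n.+1 -> K -> K) (F : K -> K) a :
  (forall j, smooth_all (f j) a) ->
  (\forall z \near a, F z = \sum_j f j z) ->
  \forall z \near a,
    wronskian f z = wronskian (fun j => if j == ord0 then F else f j) z.
Proof.
move=> sf hF.
have : \forall z \near a, forall i : 'I_n.+1,
    derive1n i F z = \sum_j derive1n i (f j) z.
  apply: near_forall => i; have := near_eq_derive1n i hF.
  by apply: filterS2 (derive1n_sum i sf) => z <- ->.
apply: filterS => z hz; rewrite /wronskian.
set A := (X in \det X = _).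
pose T : 'M[K]_n.+1 := \matrix_(i, j) ((i == j) || (j == ord0))%:R.
have -> : \det A = \det (A *m T).
  suff -> : \det (A *m T) = \det A * 1 by rewrite mulr1.
  rewrite det_mulmx; congr (_ * _); rewrite det_trig.
    by rewrite big1 // => i _; rewrite mxE eqxx.
  apply/is_trig_mxP => i j ij; rewrite mxE.
  have -> : (i == j) = false by apply/eqP => eij; rewrite eij ltnn in ij.
  by have -> : (j == ord0) = false by apply/eqP => ej; rewrite ej ltn0 in ij.
congr (\det _); apply/matrixP => i j; rewrite !mxE.
have [->|j0] := eqVneq j ord0.
  by rewrite hz; apply: eq_bigr => l _; rewrite !mxE orbT mulr1.
rewrite (bigD1 j) //= !mxE eqxx mulr1 big1 ?addr0 // => l lj.
by rewrite !mxE (negPf lj) (negPf j0) mulr0.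
Qed.

Lemma wronskian_sum_factor n (f : 'I_n.+2 -> K -> K) a j m g :
  let fw := fun j : 'I_n.+1 => f (widen_ord (leqnSn n.+1) j) in
  (forall j, smooth_all (f j) a) -> smooth_all g a ->
  (\forall z \near a, f ord_max z = \sum_j fw j z) ->
  (\forall z \near a, f j z = (z - a) ^+ m * g z) ->
  exists V, smooth_all V a /\
    \forall z \near a, wronskian fw z = (z - a) ^+ (m - n) * V z.
Proof.
move=> fw sf sg fsum fg.
have sfw i : smooth_all (fw i) a by exact: sf.
have [jmax|jlt] := eqVneq j ord_max.
  have fg0 : \forall z \near a,
      (if ord0 == ord0 :> 'I_n.+1 then f ord_max else fw ord0) z = (z - a) ^+ m * g z.
    by rewrite eqxx -jmax.
  have [|V [sV hV]] := @wronskian_factor n (fun j => if j == ord0 then f ord_max else fw j)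
    a ord0 m g _ sg fg0.
    by move=> i; case: ifP => _; exact: sf.
  exists V; split => //.
  by apply: filterS2 hV (wronskian_replace0 sfw fsum) => z <- ->.
have jn : (j < n.+1)%N.
  by rewrite ltn_neqAle -ltnS ltn_ord andbT; apply: contra jlt => /eqP e; apply/eqP/val_inj.
apply: (wronskian_factor sfw sg (j := Ordinal jn)).
by have -> : fw (Ordinal jn) = f j by congr f; exact: val_inj.
Qed.

End WronskianFactor.

(** * Blaschke products and multiplicities *)

Section BlaschkeProducts.
Variable R : realType.
Local Notation C := (Cplx R).
Implicit Types (a p z w zeta : C) (m k : C -> nat) (s : seq C) (f g h : C -> C).

Definition blaschke_factor a z : C := (z - a) / (1 - cplx_conj a * z).

Lemma cabs_blaschke_factor_lt1 a z : cabs a < 1 -> cabs z < 1 ->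
  cabs (blaschke_factor a z) < 1.
Proof.
move=> a1 z1; have q0 : 0 < cabs (1 - cplx_conj a * z).
  by rewrite cabs_gt0 factor_neq0 // ltW.
rewrite /blaschke_factor cabsM cabsV ltr_pdivrMr // mul1r.
rewrite -(ltr_pXn2r (n := 2)) ?nnegrE ?cabs_ge0 // -subr_gt0 blaschke_identity.
by rewrite mulr_gt0 // subr_gt0 expr_lt1 ?cabs_ge0.
Qed.

(** The list [s] need only contain the support of [m], so that one list can serve both the least
    common multiple and the radical. *)
Lemma blaschke_seq m s z : uniq s -> (forall a, a \in s -> cabs a < 1) ->
  (forall a, cabs a < 1 -> m a != 0%N -> a \in s) ->
  blaschke m z = \prod_(a <- s) blaschke_factor a z ^+ m a.
Proof.
move=> us s1 ms; rewrite /blaschke.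
rewrite (fsbigE s) //.
- rewrite big_seq_cond [RHS]big_seq; apply: eq_bigl => a.
  case asn: (a \in s) => //=; apply/mem_set => /=.
  by rewrite normE -toC1 toC_lt s1.
- by move=> a /= asn; rewrite normE -toC1 toC_lt s1.
- move=> a /=; rewrite normE -toC1 toC_lt => a1 asn.
  by have [->|/(ms _ a1)] := eqVneq (m a) 0%N; [rewrite expr0 | rewrite (negPf asn)].
Qed.

(* False on the circle: there infinitely many factors may equal 1 at [z], so that
   the support seen by the finitely supported product depends on [z]. *)
Lemma blaschke_infinite m z : infinite_set [set a : C | cabs a < 1 /\ m a != 0%N] ->
  cabs z < 1 -> blaschke m z = 1.
Proof.
move=> inf z1; apply: fsbig_dflt; apply: sub_infinite_set inf => a [a1 ma] /=.
split; first by rewrite normE -toC1 toC_lt.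
have := cabs_blaschke_factor_lt1 a1 z1; rewrite -/(blaschke_factor a z) => b1 b.
have : cabs (blaschke_factor a z ^+ m a) = 1 by rewrite b cabs1.
apply/eqP; rewrite lt_eqF // cabsX expr_lt1 ?cabs_ge0 //; by rewrite lt0n.
Qed.

Lemma finite_support_seq m : finite_set [set a : C | cabs a < 1 /\ m a != 0%N] ->
  exists s, [/\ uniq s, (forall a, a \in s -> cabs a < 1),
    (forall a, cabs a < 1 -> m a != 0%N -> a \in s) &
    forall a, a \in s -> m a != 0%N].
Proof.
move=> /finite_seqP[s sE]; exists (undup s); split.
- exact: undup_uniq.
- by move=> a; rewrite mem_undup => asn; have : [set` s] a by []; rewrite -sE => -[].
- move=> a a1 ma; rewrite mem_undup.
  by have : [set a : C | cabs a < 1 /\ m a != 0%N] a by []; rewrite sE.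
- by move=> a; rewrite mem_undup => asn; have : [set` s] a by []; rewrite -sE => -[].
Qed.

(** If $M>\mu$, cancelling $(z-a)^\mu$ gives $h=(z-a)^{M-\mu}g$ at points $z\ne a$ near [a], against
    $h(a)\ne 0$ and continuity. *)
Lemma order_le a (M mu : nat) g h : smooth 1 g a -> smooth 1 h a -> h a != 0 ->
  (\forall z \near a, (z - a) ^+ M * g z = (z - a) ^+ mu * h z) -> (M <= mu)%N.
Proof.
move=> sg sh ha eq; rewrite leqNgt; apply/negP => lt.
pose d z := (z - a) ^+ (M - mu) * g z - h z.
have sd : smooth 1 d a.
  apply: smoothB sh; apply: smoothM sg; apply: smoothX.
  by apply: smoothB; [exact: smooth_id | exact: smooth_cst].
have da : d a != 0.
  by rewrite /d subrr expr0n subn_eq0 leqNgt lt /= mul0r sub0r oppr_eq0.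
have dn : \forall z \near a, d z != 0.
  have cd : {for a, continuous d} := smooth_continuous sd.
  exact: cvgr_neq0 cd da.
have : \forall z \near a, d z != 0 /\ (z - a) ^+ M * g z = (z - a) ^+ mu * h z.
  by apply: filterS2 dn eq => z.
move=> /cvg_ballP[e e0 he].
have [|dz ez] := he (a + toC (e / 2)).
  rewrite [a + _]addrC addrK cabs_toC gtr0_norm ?divr_gt0 //.
  by rewrite ltr_pdivrMr // ltr_pMr // ltr1n.
have za : a + toC (e / 2) - a != 0.
  by rewrite [a + _]addrC addrK -cabs_gt0 cabs_toC gtr0_norm ?divr_gt0.
move/eqP: dz; apply; rewrite /d.
apply: (mulfI (expf_neq0 mu za)); rewrite mulr0 mulrBr mulrA -exprD.
by rewrite subnKC ?(ltnW lt) // ez subrr.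
Qed.

Lemma blaschke_factor_out s m a : cabs a < 1 -> uniq s ->
  (forall b, b \in s -> cabs b < 1) -> (a \notin s -> m a = 0%N) ->
  exists h, [/\ smooth 1 h a, h a != 0 &
    forall z, \prod_(b <- s) blaschke_factor b z ^+ m b = (z - a) ^+ m a * h z].
Proof.
move=> a1; elim: s m => [|b s IH] m.
  move=> _ _ /(_ isT) ma; exists (fun=> 1); split; first exact: smooth_cst.
    exact: oner_neq0.
  by move=> z; rewrite big_nil ma expr0 mul1r.
move=> /= /andP[bNs us] s1 hm.
have sinv (i : nat) : smooth i (fun z => (1 - cplx_conj b * z)^-1) a.
  apply: smoothV; first by rewrite factor_neq0 ?s1 ?mem_head // ltW.
  apply: smoothB; first exact: smooth_cst.
  by apply: smoothM; [exact: smooth_cst | exact: smooth_id].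
have inv0 : (1 - cplx_conj b * a)^-1 != 0.
  by rewrite invr_neq0 // factor_neq0 ?s1 ?mem_head // ltW.
have s1' c : c \in s -> cabs c < 1 by move=> cs; apply: s1; rewrite inE cs orbT.
have [ba|ba] := eqVneq b a.
  (* The multiplicity of [a] is reset to 0 for the tail, in which [a] does not recur, so that the
     induction hypothesis applies. *)
  have [|h [sh ha hE]] := IH (fun c => if c == a then 0%N else m c) us s1'.
    by rewrite eqxx.
  exists (fun z => (1 - cplx_conj b * z)^-1 ^+ m a * h z); split.
  - exact: smoothM (smoothX _ (sinv 1%N)) sh.
  - by rewrite mulf_neq0 // expf_neq0.
  move=> z; rewrite big_cons {1}ba /blaschke_factor exprMn -mulrA; congr (_ * _).
    by rewrite ba.
  rewrite ba; congr (_ * _).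
  have := hE z; rewrite eqxx expr0 mul1r => <-.
  rewrite big_seq [RHS]big_seq; apply: eq_bigr => c cs.
  by case: eqP => // ca; move: bNs; rewrite ba -ca cs.
have [|h [sh ha hE]] := IH m us s1'.
  by move=> aNs; apply: hm; rewrite inE eq_sym (negPf ba).
exists (fun z => blaschke_factor b z ^+ m b * h z); split.
- apply: smoothM sh; apply: smoothX; apply: smoothM (sinv 1%N).
  by apply: smoothB; [exact: smooth_id | exact: smooth_cst].
- rewrite mulf_neq0 // expf_neq0 // /blaschke_factor mulf_neq0 //.
  by rewrite subr_eq0 eq_sym.
by move=> z; rewrite big_cons hE mulrCA.
Qed.

(** [get] returns 0 where no order exists, so a nonzero value certifies a genuine order. *)
Lemma multiplicity_spec (K : numFieldType) (f : K -> K) (a : K) :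
  multiplicity f a != 0%N -> has_multiplicity f a (multiplicity f a).
Proof.
rewrite /multiplicity; case: (pselect (exists i, has_multiplicity f a i)).
  by move=> ex _; exact: getPex.
by move=> nex; rewrite getPN // => i hi; apply: nex; exists i.
Qed.

Lemma multiplicity_zero f a : multiplicity f a != 0%N -> f a = 0.
Proof.
move=> hm; have [g [_ _ fg]] := multiplicity_spec hm.
by rewrite (nbhs_singleton fg) subrr expr0n (negPf hm) mul0r.
Qed.

Lemma near_disk a : cabs a < 1 -> \forall z \near a, cabs z < 1.
Proof.
move=> a1; apply/cvg_ballP; exists (1 - cabs a); first by rewrite subr_gt0.
by move=> z; have := cabs_dist z a; lra.
Qed.

(** For finite support the orders are compared through [blaschke_factor_out]; for infinite support
    the product is 1 in the disk and has no zero there. *)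
Lemma multiplicity_blaschke_le m a : cabs a < 1 -> (multiplicity (blaschke m) a <= m a)%N.
Proof.
move=> a1; have [->//|hm] := eqVneq (multiplicity (blaschke m) a) 0%N.
have [g [ag ga fg]] := multiplicity_spec hm.
have [fin|inf] := pselect (finite_set [set a : C | cabs a < 1 /\ m a != 0%N]).
  have [s [us s1 ms _]] := finite_support_seq fin.
  have aNs : a \notin s -> m a = 0%N.
    by move=> aNs; apply/eqP; apply: contraNT aNs; exact: ms.
  have [h [sh ha hE]] := blaschke_factor_out a1 us s1 aNs.
  apply: (order_le (analytic_smooth 1 ag) sh ha).
  by apply: filterS fg => z <-; rewrite -hE -blaschke_seq.
by have := multiplicity_zero hm; rewrite blaschke_infinite // => /eqP; rewrite oner_eq0.
Qed.

Lemma blaschke_zeros_finite m :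
  finite_set [set a : C | cabs a < 1 /\ blaschke m a = 0].
Proof.
have [fin|inf] := pselect (finite_set [set a : C | cabs a < 1 /\ m a != 0%N]).
  have [s [us s1 ms _]] := finite_support_seq fin.
  apply: sub_finite_set (finite_seq s) => a [a1].
  rewrite (blaschke_seq _ us s1 ms) => /eqP; rewrite prodf_seq_eq0 => /hasP[b bs] /=.
  rewrite expf_eq0 => /andP[_]; rewrite mulf_eq0 invr_eq0.
  rewrite (negPf (factor_neq0 (s1 b bs) (ltW a1))) orbF subr_eq0 => /eqP ->.
  exact: bs.
apply: sub_finite_set (finite_set0 C) => a [a1].
by rewrite blaschke_infinite // => /eqP; rewrite oner_eq0.
Qed.

End BlaschkeProducts.

(** * Derivatives of Blaschke products on the circle *)

Section LogarithmicDerivative.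
Variable K : numFieldType.
Implicit Types (f g : K -> K) (x y z a b : K).

(** Derivatives are written $xf/z$ with $x=zf'/f$, a quantity additive under products and equal to
    the Poisson weight for a Blaschke factor on the circle. *)
Lemma is_derive_log_mul f g x y z :
  is_derive z 1 f (x * f z / z) -> is_derive z 1 g (y * g z / z) ->
  is_derive z 1 (fun w => f w * g w) ((x + y) * (f z * g z) / z).
Proof.
move=> df dg; have := is_deriveM df dg; rewrite -![_ *: _]/(_ * _).
have -> : f z * (y * g z / z) + g z * (x * f z / z) = (x + y) * (f z * g z) / z.
  by ring.
exact.
Qed.

Lemma is_derive_log_one z : is_derive z 1 (fun=> 1 : K) (0 * 1 / z).
Proof. by rewrite !mul0r; exact: is_derive_cst. Qed.

Lemma is_derive_log_exp f x z n : is_derive z 1 f (x * f z / z) ->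
  is_derive z 1 (fun w => f w ^+ n) (n%:R * x * f z ^+ n / z).
Proof.
move=> df; elim: n => [|n IH]; first by rewrite mul0r; exact: is_derive_log_one.
have -> : (fun w => f w ^+ n.+1) = (fun w => f w * f w ^+ n).
  by apply/funext => w; rewrite exprS.
have -> : n.+1%:R * x * f z ^+ n.+1 / z = (x + n%:R * x) * (f z * f z ^+ n) / z.
  by rewrite exprS -natr1; ring.
exact: is_derive_log_mul.
Qed.

Lemma is_derive_log_prod (s : seq K) (F : K -> K -> K) (x : K -> K) (k : K -> nat) z :
  (forall a, a \in s -> is_derive z 1 (F a) (x a * F a z / z)) ->
  is_derive z 1 (fun w => \prod_(a <- s) F a w ^+ k a)
    ((\sum_(a <- s) (k a)%:R * x a) * (\prod_(a <- s) F a z ^+ k a) / z).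
Proof.
elim: s => [|a s IH] H.
  have -> : (fun w => \prod_(a <- [::]) F a w ^+ k a) = (fun=> 1).
    by apply/funext => w; rewrite big_nil.
  by rewrite !big_nil; exact: is_derive_log_one.
have -> : (fun w => \prod_(b <- a :: s) F b w ^+ k b) =
    (fun w => F a w ^+ k a * \prod_(b <- s) F b w ^+ k b).
  by apply/funext => w; rewrite big_cons.
rewrite !big_cons; apply: is_derive_log_mul.
  by apply: is_derive_log_exp; apply: H; rewrite mem_head.
by apply: IH => b bs; apply: H; rewrite inE bs orbT.
Qed.

Lemma is_derive_moebius a b z : z != 0 -> z - a != 0 -> 1 - b * z != 0 ->
  is_derive z 1 (fun w => (w - a) / (1 - b * w))
    ((1 - a * b) * z / ((z - a) * (1 - b * z)) * ((z - a) / (1 - b * z)) / z).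
Proof.
move=> z0 za q0.
have d2 : is_derive z 1 (fun w : K => 1 - b * w) (- b).
  by apply: is_derive_eq; rewrite -![_ *: _]/(_ * _) mulr1 sub0r.
have d3 : is_derive z 1 (fun w => (1 - b * w)^-1) (- (1 - b * z) ^- 2 * (- b)).
  have [e1 e2] := d2; apply: DeriveDef; first exact: derivableV.
  have e3 := @deriveV K _ (fun w : K => 1 - b * w) z 1 q0 e1.
  by rewrite e3 e2.
have d1 : is_derive z 1 (fun w : K => w - a) 1.
  by apply: is_derive_eq; rewrite subr0.
have := is_deriveM d1 d3; rewrite -![_ *: _]/(_ * _).
set D := (_ + _); set E := (X in _ -> is_derive _ _ _ X).
have -> : E = D; last by [].
by rewrite /E /D; field; rewrite q0 za z0.
Qed.

End LogarithmicDerivative.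

Section BlaschkeDerivative.
Variable R : realType.
Local Notation C := (Cplx R).
Implicit Types (a z zeta : C) (m : C -> nat) (s : seq C).

Lemma circle_neq zeta a : cabs zeta = 1 -> cabs a < 1 -> zeta - a != 0.
Proof.
move=> z1 a1; rewrite -cabs_gt0; have := cabs_dist zeta a; rewrite z1; lra.
Qed.

Lemma is_derive_blaschke_factor a zeta : cabs a < 1 -> cabs zeta = 1 ->
  is_derive zeta 1 (blaschke_factor a)
    (toC (poisson a zeta) * blaschke_factor a zeta / zeta).
Proof.
move=> a1 z1.
have z0 : zeta != 0 by rewrite -cabs_gt0 z1.
have za := circle_neq z1 a1.
have q0 : 1 - cplx_conj a * zeta != 0 by rewrite factor_neq0 // z1.
have -> : toC (poisson a zeta) =
    (1 - a * cplx_conj a) * zeta / ((zeta - a) * (1 - cplx_conj a * zeta)).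
  rewrite /poisson toCM toCV toCB toC1 -!mul_conj conjB.
  (* Since $\overline\zeta\zeta=1$, the denominator becomes $\zeta|\zeta-a|^2$. *)
  have -> : 1 - cplx_conj a * zeta = (cplx_conj zeta - cplx_conj a) * zeta.
    by rewrite mulrBl; congr (_ - _); rewrite mulrC mul_conj z1 expr1n.
  by rewrite mulrA -mulf_div mulfV // mulr1.
exact: is_derive_moebius.
Qed.

Lemma smooth_blaschke_factor a z k : cabs a < 1 -> cabs z <= 1 ->
  smooth k (blaschke_factor a) z.
Proof.
move=> a1 z1; apply: smoothM.
  by apply: smoothB; [exact: smooth_id | exact: smooth_cst].
apply: smoothV; first exact: factor_neq0.
apply: smoothB; first exact: smooth_cst.
by apply: smoothM; [exact: smooth_cst | exact: smooth_id].
Qed.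

(** On the circle $|B|=1$ and $\zeta B'/B$ is a sum of nonnegative reals, so taking the modulus
    loses nothing. *)
Lemma cabs_derive_blaschke m s zeta : uniq s -> (forall a, a \in s -> cabs a < 1) ->
  (forall a, cabs a < 1 -> m a != 0%N -> a \in s) -> cabs zeta = 1 ->
  cabs (derive1 (blaschke m) zeta) = \sum_(a <- s) (m a)%:R * poisson a zeta.
Proof.
move=> us s1 ms z1.
have BE : blaschke m = (fun z => \prod_(a <- s) blaschke_factor a z ^+ m a).
  by apply/funext => z; exact: blaschke_seq.
have [_ dB] := is_derive_log_prod m
  (fun a (asn : a \in s) => is_derive_blaschke_factor (s1 a asn) z1).
rewrite (@derive1E C _ (blaschke m) zeta) BE dB cabsM cabsM cabsV z1 invr1 mulr1.
have -> : cabs (\prod_(a <- s) blaschke_factor a zeta ^+ m a) = 1.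
  rewrite cabs_prod big_seq big1 // => a asn.
  rewrite cabsX /blaschke_factor cabsM cabsV cabs_factor_circle // mulfV ?expr1n //.
  by rewrite gt_eqF // cabs_gt0 circle_neq // s1.
have -> : \sum_(a <- s) (m a)%:R * toC (poisson a zeta) =
    toC (\sum_(a <- s) (m a)%:R * poisson a zeta).
  rewrite (big_morph _ (@toCD R) (toC0 R)).
  by apply: eq_bigr => a _; rewrite toCM toC_nat.
rewrite mulr1 cabs_toC ger0_norm // big_seq sumr_ge0 // => a /s1 a1.
by rewrite mulr_ge0 // divr_ge0 ?sqr_ge0 // subr_ge0 expr_le1 ?cabs_ge0 // ltW.
Qed.

Lemma smooth_blaschke m s k z : uniq s -> (forall a, a \in s -> cabs a < 1) ->
  (forall a, cabs a < 1 -> m a != 0%N -> a \in s) -> cabs z <= 1 ->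
  smooth k (blaschke m) z.
Proof.
move=> us s1 ms z1.
have -> : blaschke m = (fun z => \prod_(a <- s) blaschke_factor a z ^+ m a).
  by apply/funext => w; exact: blaschke_seq.
apply: smooth_prod => a asn; apply: smoothX.
by apply: smooth_blaschke_factor => //; exact: s1.
Qed.

End BlaschkeDerivative.

(** * The norm on the circle *)

Section CircleNorm.
Variable R : realType.
Local Notation C := (Cplx R).
Implicit Types (g : C -> C) (zeta : C) (t : R).

Lemma cabs_circle_point t : cabs (circle_point t) = 1.
Proof.
apply: (pexpIrn (n := 2)); rewrite ?nnegrE ?cabs_ge0 // expr1n cabs_sqr /=.
exact: cos2Dsin2.
Qed.

Lemma circle_point_surj zeta : cabs zeta = 1 ->
  exists2 t, 0 <= t < 2 * pi & circle_point t = zeta.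
Proof.
move=> z1; have := cabs_sqr zeta; rewrite z1 expr1n.
case: zeta {z1} => x y /= /esym xy.
have x1 : -1 <= x <= 1 by apply/andP; split; nra.
have y2 : 1 - x ^+ 2 = y ^+ 2 by rewrite -xy addrAC subrr add0r.
have pi0 : 0 < pi :> R := pi_gt0 R.
have [y0|y0] := leP 0 y.
  exists (acos x).
    by rewrite acos_ge0 //=; have := acos_lepi x1; lra.
  by rewrite /circle_point acosK ?in_itv //= sin_acos // y2 sqrtr_sqr ger0_norm.
(* Strictness gives $\arccos x>0$, which keeps the parameter $2\pi-\arccos x$ below $2\pi$. *)
have xlt : -1 <= x < 1.
  apply/andP; split; first by case/andP: x1.
  rewrite lt_neqAle; case/andP: x1 => _ ->; rewrite andbT.
  by apply/eqP => xe; move: y2; rewrite xe expr1n subrr => /esym/eqP; rewrite sqrf_eq0 lt_eqF.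
exists (pi *+ 2 - acos x).
  have := acos_gt0 xlt; have := acos_lepi x1; rewrite -mulr_natl; lra.
rewrite /circle_point cosB sinB cos2pi sin2pi !mul1r !mul0r addr0 sub0r.
by rewrite acosK ?in_itv //= sin_acos // y2 sqrtr_sqr ltr0_norm // opprK.
Qed.

Lemma continuous_circle_point : continuous (@circle_point R : R -> C).
Proof.
move=> t; have cv : (cos u, sin u) @[u --> t] --> (cos t, sin t).
  exact: (cvg_pair (FF := nbhs_filter t) (@continuous_cos R t) (@continuous_sin R t)).
exact: (cvg_comp (fun u => (cos u, sin u)) (@of_pair R) cv (@continuous_of_pair R _)).
Qed.

Lemma continuous_on_circle g t : {for (circle_point t), continuous g} ->
  {for t, continuous (fun u => cabs (g (circle_point u)))}.
Proof.
move=> cg; apply: (continuous_comp (g := @cabs R)); last exact: continuous_cabs_fun.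
by apply: (continuous_comp (g := g)); [exact: continuous_circle_point | exact: cg].
Qed.

(** The norm of exponent infinity unfolds to an essential supremum only when the total mass is
    positive. *)
Lemma arc_measureT_gt0 : (0 < arc_measure R [set: R])%E.
Proof.
rewrite /arc_measure /mrestr setTI lebesgue_measure_itv /= lte_fin mulr_gt0 ?pi_gt0 //.
by rewrite -EFinB lte_fin subr0 mulr_gt0 ?pi_gt0.
Qed.

Lemma norm_circleE g : norm_infty_circle g =
  ess_sup (arc_measure R) (EFin \o (fun t => cabs (g (circle_point t)))).
Proof.
rewrite /norm_infty_circle unlock arc_measureT_gt0; congr (ess_sup _ _).
by apply/funext => t /=; rewrite ger0_norm // -/(cabs _) cabs_ge0.
Qed.

Lemma norm_circle_le g (X : R) : (forall zeta, cabs zeta = 1 -> cabs (g zeta) <= X) ->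
  (norm_infty_circle g <= X%:E)%E.
Proof.
move=> gX; rewrite norm_circleE; apply/ess_supP; apply: filterE => t /=.
by rewrite lee_fin gX // cabs_circle_point.
Qed.

(** If the value exceeded the essential supremum, continuity would make a whole arc exceed it, and
    that arc would lie in a null set. *)
Lemma norm_circle_ge g zeta : cabs zeta = 1 -> {for zeta, continuous g} ->
  ((cabs (g zeta))%:E <= norm_infty_circle g)%E.
Proof.
move=> /circle_point_surj[t /andP[t0 t1] <-] /continuous_on_circle ch.
rewrite norm_circleE leNgt; apply/negP => lt.
set N := ess_sup _ _ in lt.
have [B [mB B0 NB]] := ess_sup_ge (arc_measure R) (EFin \o (fun t => cabs (g (circle_point t)))).
(* A real threshold replaces [N], which a priori may be infinite. *)
have [r Nr rlt] : exists2 r : R, (N <= r%:E)%E & r < cabs (g (circle_point t)).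
  move: lt; case: N => [r| |] // lt; first by exists r; rewrite // -lte_fin.
  by exists (cabs (g (circle_point t)) - 1); rewrite ?leNye // gtrBl.
have /cvgrPdist_lt/(_ (cabs (g (circle_point t)) - r)) := ch.
rewrite subr_gt0 => /(_ rlt) /nbhs_ballP[d /= d0 hd].
(* Only parameters to the right of [t] are used, since [t] may be 0; the cut at $2\pi$ stays where
   the measure lives. *)
pose u := Num.min (t + d) (2 * pi).
have tu : t < u by rewrite lt_min t1 andbT ltrDl.
have sub : `[t, u[ `<=` B `&` `[0, 2 * pi[.
  move=> x /=; rewrite in_itv /= lt_min => /andP[tx /andP[xd xp]]; split.
    apply: NB => /= h.
    have := hd x; rewrite /ball /= ler0_norm ?subr_le0 // opprB ltrBlDl => /(_ xd) h2.
    have := le_trans h Nr; rewrite lee_fin => h3.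
    by move: h2; rewrite ltr_norml => /andP[_]; lra.
  by rewrite in_itv /= xp (le_trans t0 tx).
have : (lebesgue_measure `[t, u[%classic <= lebesgue_measure (B `&` `[0%R, (2 * pi)%R[))%E.
  by apply: le_measure => //; rewrite inE //; apply: measurableI.
have -> : lebesgue_measure (B `&` `[0, 2 * pi[) = 0%E by exact: B0.
rewrite lebesgue_measure_itv /= lte_fin tu -EFinB lee_fin; lra.
Qed.

Lemma norm_circle_fin g : (forall zeta, cabs zeta = 1 -> {for zeta, continuous g}) ->
  exists2 x : R, norm_infty_circle g = x%:E &
    forall zeta, cabs zeta = 1 -> cabs (g zeta) <= x.
Proof.
move=> cg; have pi0 : 0 < pi :> R := pi_gt0 R.
have pi2 : 0 <= 2 * pi :> R by rewrite mulr_ge0 // ltW.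
have ch : {within `[0, 2 * pi], continuous (fun t => cabs (g (circle_point t)))}.
  apply: continuous_in_subspaceT => t _; apply: continuous_on_circle; apply: cg.
  exact: cabs_circle_point.
have [t _ tmax] := EVT_max pi2 ch.
have le : (norm_infty_circle g <= (cabs (g (circle_point t)))%:E)%E.
  apply: norm_circle_le => zeta /circle_point_surj[u /andP[u0 u1] <-].
  by apply: tmax; rewrite in_itv /= u0 ltW.
have ge zeta : cabs zeta = 1 -> ((cabs (g zeta))%:E <= norm_infty_circle g)%E.
  by move=> z1; apply: norm_circle_ge => //; exact: cg.
exists (cabs (g (circle_point t))).
  by apply/eqP; rewrite eq_le le ge // cabs_circle_point.
by move=> zeta z1; rewrite -lee_fin; apply: le_trans (ge _ z1) le.
Qed.

End CircleNorm.

Lemma ereal_combine (R : realFieldType) (X a b d e : \bar R) (x A M N Q : R) :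
  a = A%:E -> b = M%:E -> d = N%:E -> e = Q%:E ->
  (X <= (158 * (A * (M + x * N * Q)))%:E ->
   (158^-1)%:E * X <= a * (b + x%:E * d * e))%E.
Proof.
move=> -> -> -> -> leX.
have c0 : (0 <= (158^-1 : R)%:E)%E by rewrite lee_fin invr_ge0.
apply: le_trans (lee_wpmul2l c0 leX) _.
have -> y : ((158^-1 : R)%:E * (158 * y)%:E = y%:E)%E.
  by rewrite -EFinM mulKf ?pnatr_eq0.
exact: lexx.
Qed.

(** * The inequality *)

Section Wronskian.
Variables (R : realType) (n : nat).
Local Notation C := (Cplx R).
Variable f : 'I_n.+2 -> C -> C.
Let fw (j : 'I_n.+1) := f (widen_ord (leqnSn n.+1) j).
Let W := wronskian fw.
Let B (j : 'I_n.+2) := blaschke_of (f j).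
Let mL (a : C) := (\max_(j < n.+2) multiplicity (B j) a)%N.
Let mR (a : C) := if \prod_(j < n.+2) B j a == 0 then 1%N else 0%N.

Lemma analytic_near_disk_smooth (g : C -> C) p : analytic_near_closed_disk g ->
  cabs p <= 1 -> smooth_all g p.
Proof.
move=> [U [_ DU aU]] p1 k; apply: analytic_smooth; apply: aU; apply: DU => /=.
by rewrite normE -toC1 toC_le.
Qed.

Hypothesis af : forall j, analytic_near_closed_disk (f j).
Hypothesis fsum : forall z : C, `|z| <= 1 -> f ord_max z = \sum_(j < n.+1) fw j z.

Lemma smooth_wronskian_disk p : cabs p <= 1 -> smooth_all W p.
Proof.
by move=> p1; apply: smooth_wronskian => j; exact: analytic_near_disk_smooth (af _) p1.
Qed.

Lemma rad_support_finite : finite_set [set a : C | cabs a < 1 /\ mR a != 0%N].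
Proof.
have fin : finite_set (\bigcup_(j in [set: 'I_n.+2]) [set a : C | cabs a < 1 /\ B j a = 0]).
  by apply: bigcup_finite => // j _; exact: blaschke_zeros_finite.
apply: sub_finite_set fin => a [a1]; rewrite /mR; case: ifP => // /prodf_eq0[j _ /eqP Bj] _.
by exists j.
Qed.

Lemma lcm_multiplicity_rad a : mL a != 0%N -> mR a = 1%N.
Proof.
move=> ma; have [|j mj] := @bigop.eq_bigmax _ (fun j : 'I_n.+2 => multiplicity (B j) a).
  by rewrite card_ord.
move: ma; rewrite /mL mj => /multiplicity_zero Bj.
by rewrite /mR; case: ifP => // /prodf_eq0[]; exists j => //; rewrite Bj.
Qed.

Lemma wronskian_zero_order a : cabs a < 1 -> exists V, smooth_all V a /\
  \forall z \near a, W z = (z - a) ^+ (mL a - n) * V z.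
Proof.
move=> a1; have [|j mj] := @bigop.eq_bigmax _ (fun j : 'I_n.+2 => multiplicity (B j) a).
  by rewrite card_ord.
have := multiplicity_blaschke_le (multiplicity (f j)) a1.
rewrite -/(blaschke_of _) -/(B j) -mj -/(mL a) => mle.
(* Order 0 includes the default value for an [f j] vanishing identically near [a]; then [mL a] is 0
   and [W] itself is the cofactor. *)
have [m0|mf] := eqVneq (multiplicity (f j) a) 0%N.
  move: mle; rewrite m0 leqn0 => /eqP ->; exists W; split.
    by apply: smooth_wronskian_disk; exact: ltW.
  by apply: nbhsT => z; rewrite sub0n expr0 mul1r.
have [g [ag ga fg]] := multiplicity_spec mf.
have sg : smooth_all g a by move=> k; exact: analytic_smooth.
have sf i : smooth_all (f i) a := analytic_near_disk_smooth (af i) (ltW a1).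
have ns : \forall z \near a, f ord_max z = \sum_j fw j z.
  apply: filterS (near_disk a1) => z z1; apply: fsum.
  by rewrite normE -toC1 toC_le ltW.
have [V [sV hV]] := wronskian_sum_factor sf sg ns fg.
exists (fun z => (z - a) ^+ (multiplicity (f j) a - n - (mL a - n)) * V z); split.
  move=> k; apply: smoothM (sV k); apply: smoothX.
  by apply: smoothB; [exact: smooth_id | exact: smooth_cst].
apply: filterS hV => z hz.
by rewrite mulrA -exprD subnKC ?leq_sub2r.
Qed.

Hypothesis W0 : forall z : C, `|z| = 1 -> W z != 0.

(** Each multiplicity is at most $(m-n)+n$, with truncated difference. The first part is bounded by
    [poisson_sum_le]; the second gives $n$ times the Poisson sum of the radical. *)
Lemma blaschke_lcm_bound :
  ((158^-1)%:E * norm_infty_circle (derive1 (blaschke mL))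
   <= norm_infty_circle (fun z => (W z)^-1)%R *
      (norm_infty_circle (derive1 W)
       + n%:R%:E * norm_infty_circle W * norm_infty_circle (derive1 (blaschke mR))))%E.
Proof.
have [s [us s1 ms sm]] := finite_support_seq rad_support_finite.
have msL a : cabs a < 1 -> mL a != 0%N -> a \in s.
  by move=> a1 /lcm_multiplicity_rad mRa; apply: ms => //; rewrite mRa.
have W0' zeta : cabs zeta = 1 -> W zeta != 0.
  by move=> z1; apply: W0; rewrite normE z1.
have sW p : cabs p = 1 -> smooth_all W p.
  by move=> p1; apply: smooth_wronskian_disk; rewrite p1.
have [A eA hA] : exists2 x : R, norm_infty_circle (fun z => (W z)^-1) = x%:E &
    forall zeta, cabs zeta = 1 -> cabs (W zeta)^-1 <= x.
  apply: (norm_circle_fin (g := fun z => (W z)^-1)) => zeta z1.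
  have sV : smooth 1 (fun z => (W z)^-1) zeta by apply: smoothV (W0' _ z1) (sW _ z1 1%N).
  exact: (smooth_continuous sV).
have [M eM hM] : exists2 x : R, norm_infty_circle (derive1 W) = x%:E &
    forall zeta, cabs zeta = 1 -> cabs (derive1 W zeta) <= x.
  apply: (norm_circle_fin (g := derive1 W)) => zeta z1.
  have [_ sW'] : smooth 2 W zeta := sW _ z1 2%N.
  have {}sW' : smooth 1 (derive1 W) zeta := sW'.
  exact: (smooth_continuous sW').
have [N eN hN] : exists2 x : R, norm_infty_circle W = x%:E &
    forall zeta, cabs zeta = 1 -> cabs (W zeta) <= x.
  apply: (norm_circle_fin (g := W)) => zeta z1.
  exact: (smooth_continuous (sW _ z1 1%N)).
have [Q eQ hQ] : exists2 x : R, norm_infty_circle (derive1 (blaschke mR)) = x%:E &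
    forall zeta, cabs zeta = 1 -> cabs (derive1 (blaschke mR) zeta) <= x.
  apply: (norm_circle_fin (g := derive1 (blaschke mR))) => zeta z1.
  have [_ sB] : smooth 2 (blaschke mR) zeta.
    by apply: (smooth_blaschke 2 us s1 ms); rewrite z1.
  have {}sB : smooth 1 (derive1 (blaschke mR)) zeta := sB.
  exact: (smooth_continuous sB).
have one1 : cabs (1 : C) = 1 := cabs1 R.
have A0 : 0 < A.
  apply: lt_le_trans (hA 1 one1); by rewrite cabs_gt0 invr_neq0 // W0'.
have hA1 zeta : cabs zeta = 1 -> 1 <= A * cabs (W zeta).
  move=> z1; rewrite -ler_pdivrMr ?cabs_gt0 ?W0' // mul1r -cabsV; exact: hA.
(* This inequality brings the factor $\|1/W\|_\infty\|W\|_\infty$ into the radical term. *)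
have AN : 1 <= A * N.
  by apply: le_trans (hA1 1 one1) _; rewrite ler_pM2l // hN.
have M0 : 0 <= M := le_trans (cabs_ge0 _) (hM 1 one1).
have Q0 : 0 <= Q := le_trans (cabs_ge0 _) (hQ 1 one1).
have loc a : a \in s -> exists V, smooth 3 V a /\
    \forall z \near a, W z = (z - a) ^+ (mL a - n) * V z.
  move=> /s1 /wronskian_zero_order [V [sV hV]].
  by exists V; split => //; exact: sV.
have bound zeta : cabs zeta = 1 ->
    cabs (derive1 (blaschke mL) zeta) <= 158 * (A * (M + n%:R * N * Q)).
  move=> z1; rewrite (cabs_derive_blaschke us s1 msL z1).
  have P0 a : a \in s -> 0 <= poisson a zeta.
    by move=> /s1 a1; rewrite divr_ge0 ?sqr_ge0 // subr_ge0 expr_le1 ?cabs_ge0 // ltW.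
  have RB : \sum_(a <- s) poisson a zeta <= Q.
    apply: le_trans (hQ _ z1); rewrite (cabs_derive_blaschke us s1 ms z1).
    rewrite big_seq [leRHS]big_seq; apply: ler_sum => a asn.
    by rewrite ler_peMl ?P0 // ler1n lt0n sm.
  have := poisson_sum_le us s1 (fun p p1 => smooth_wronskian_disk p1 3%N) loc A0 hA1 hM z1.
  move=> key; apply: (@le_trans _ _
      (\sum_(a <- s) (mL a - n)%:R * poisson a zeta + n%:R * \sum_(a <- s) poisson a zeta)).
    rewrite mulr_sumr -big_split /= big_seq [leRHS]big_seq; apply: ler_sum => a asn.
    by rewrite -mulrDl ler_wpM2r ?P0 // -natrD ler_nat addnC -leq_subLR.
  have nQ : 0 <= n%:R * Q by rewrite mulr_ge0.
  have := ler_wpM2r nQ AN; have := ler_wpM2l (ler0n R n) RB; nra.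
exact: ereal_combine eA eM eN eQ (norm_circle_le bound).
Qed.

End Wronskian.

Theorem proposition1p1 (R : realType) :
  exists c : R, 0 < c /\
    forall (n : nat) (f : 'I_n.+2 -> Cplx R -> Cplx R),
      (1 <= n)%N ->
      (forall j, analytic_near_closed_disk (f j)) ->
      (forall z : Cplx R, `|z| <= 1 ->
        f ord_max z = \sum_(j < n.+1) f (widen_ord (leqnSn n.+1) j) z) ->
      let W := wronskian (fun j : 'I_n.+1 => f (widen_ord (leqnSn n.+1) j)) in
      (forall z : Cplx R, `|z| = 1 -> W z != 0) ->
      let B := fun j : 'I_n.+2 => blaschke_of (f j) in
      let LB := blaschke_lcm B in
      let RB := blaschke_rad (fun z => \prod_(j < n.+2) B j z) in
      (c%:E * norm_infty_circle (derive1 LB)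
       <= norm_infty_circle (fun z => (W z)^-1)%R *
          (norm_infty_circle (derive1 W)
           + n%:R%:E * norm_infty_circle W * norm_infty_circle (derive1 RB)))%E.
Proof.
exists 158^-1; split=> [|n f _ af fsum W W0]; first by rewrite invr_gt0.
exact: (blaschke_lcm_bound af fsum W0).
Qed.
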